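(* Let $g:[0,1]\to[0,1]$ be a piecewise linear unimodal map. If there exists a non-trivial piecewise linear commutator of $g$, then $g$ is topologically conjugate to the tent map $f$ and, moreover, the conjugacy is piecewise linear; that is, there is a piecewise linear homeomorphism $h:[0,1]\to[0,1]$ with $h\circ f=g\circ h$.
   Context: A continuous map $g:[0,1]\to[0,1]$ is called unimodal if there is $v\in(0,1)$ such that $g$ is (strictly) increasing on $[0,v]$, (strictly) decreasing on $[v,1]$, and $g(0)=g(1)=0$, $g(v)=1$. The tent map is $f:[0,1]\to[0,1]$, $f(x)=1-|1-2x|$. Piecewise linear means continuous and affine on each of finitely many intervals whose union is $[0,1]$. A non-trivial piecewise linear commutator of $g$ is a continuous piecewise linear map $\psi:[0,1]\to[0,1]$ such that $g\circ\psi=\psi\circ g$ and $\psi$ is neither a constant map nor an iterate $g^n$ of $g$, $n\ge 0$ (with $g^0=\mathrm{id}$). *)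

(* Defs.v *)
From HB Require Import structures.
From mathcomp Require Import all_boot all_order all_algebra.
From mathcomp Require Import all_classical all_reals all_analysis.

Set Implicit Arguments.
Unset Strict Implicit.
Unset Printing Implicit Defensive.

Import Order.TTheory GRing.Theory Num.Theory.
Import numFieldNormedType.Exports.

Local Open Scope classical_set_scope.
Local Open Scope ring_scope.

(* A map [0,1] -> [0,1] is encoded as a total function R -> R sending [0,1]
   into itself; its values outside [0,1] are never used: continuity is for the
   subspace topology of [0,1], and all equations are restricted to [0,1]. *)

Definition unit_map (R : realType) (g : R -> R) : Prop :=
  set_fun `[0, 1] `[0, 1] g /\ {within `[0, 1], continuous g}.

Definition unimodal (R : realType) (g : R -> R) : Prop :=
  unit_map g /\
  exists v : R,
    [/\ 0 < v < 1,
        {in `[0, v] &, {homo g : x y / x < y}},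
        {in `[v, 1] &, {homo g : x y / x < y >-> y < x}},
        g 0 = 0 /\ g 1 = 0
      & g v = 1].

Definition tent (R : realType) (x : R) : R := 1 - `|1 - 2 * x|.

Definition affine_on (R : realType) (g : R -> R) (i : interval R) : Prop :=
  exists a b : R, {in i, forall x, g x = a * x + b}.

(* The intervals may be open, closed, or degenerate, and may overlap. *)
Definition piecewise_linear (R : realType) (g : R -> R) : Prop :=
  {within `[0, 1], continuous g} /\
  exists s : seq (interval R),
    \bigcup_(i in [set` s]) [set` i] = `[0, 1]%classic :> set R /\
    (forall i, i \in s -> affine_on g i).

Definition commutator (R : realType) (g psi : R -> R) : Prop :=
  {in `[0, 1], g \o psi =1 psi \o g}.

Definition nontrivial_pl_commutator (R : realType) (g psi : R -> R) : Prop :=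
  [/\ unit_map psi,
      piecewise_linear psi,
      commutator g psi,
      ~ (exists c : R, {in `[0, 1], forall x, psi x = c})
    & ~ (exists n : nat, {in `[0, 1], psi =1 iter n g})].

Definition unit_homeomorphism (R : realType) (h : R -> R) : Prop :=
  unit_map h /\
  exists k : R -> R,
    [/\ unit_map k, {in `[0, 1], cancel h k} & {in `[0, 1], cancel k h}].

Definition conjugacy (R : realType) (f g h : R -> R) : Prop :=
  unit_homeomorphism h /\ {in `[0, 1], h \o f =1 g \o h}.

(* Main.v *)
Require Import Defs.
From mathcomp Require Import all_boot all_order all_algebra.
From mathcomp Require Import all_classical all_reals all_analysis.
From mathcomp Require Import ring lra zify.

(** Write g^N for the N-th iterate of g, v for the turning point of g, and psi
    for the commutator. The proof linearises g at a repelling fixed point and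
    compares the two dilations that g and psi induce there.

    Let p be the largest fixed point of g in [0, v]. It repels on its right,
    where g is a dilation by some a > 1 ([repelling_exists]). Every point of
    [0, 1] is the image by an iterate of points arbitrarily close to p
    ([orbit_reach]), so psi is determined by its germ on the right of p, and that
    germ is affine. All germs except a dilation psi (p + s) = p + k * s with
    k > 0 are impossible ([commutator_linear]).

    The map g^N has 2 ^ N laps, each mapped onto [0, 1]; call their endpoints
    knots. For fixed n, the coordinate of the n-th knot of g^N at p is
    z n / a ^ N for N large, and z (2 * n) = a * z n ([knot_scaling]). Because
    g^N folds at its interior knots, psi has to map knots to knots
    ([commutator1]), and it stretches each lap near p over the same number M of
    laps ([commutator_index_gap]). Hence z (M * n) = k * z n
    ([commutator_scaling]), and M is not a power of 2, or psi would be an iterate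
    of g. As 2 and M are multiplicatively independent and z is increasing,
    z n = z 1 * n ^ al ([power_law]).

    Finally some iterate of g vanishes at a knot and is affine on its right, where
    knots of higher levels accumulate. So the increments of n ^ al at the powers
    2 ^ i are given by an affine expression in a ^ i, which leaves only p = 0,
    al = 1 and a = 2 ([power_law_rigid]). The knots near 0 are then equally
    spaced, and a rescaled iterate of g on its first lap is the desired conjugacy
    ([tent_conjugate]). *)

Set Implicit Arguments.
Unset Strict Implicit.
Unset Printing Implicit Defensive.

Import Order.TTheory GRing.Theory Num.Theory.
Import numFieldNormedType.Exports.

Local Open Scope classical_set_scope.
Local Open Scope ring_scope.

(** * Piecewise linear maps of the unit interval *)

Section PiecewiseLinear.
Variable R : realType.
Implicit Types (f g : R -> R) (x y s : R) (A B : set R).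

Lemma within_continuous_epsP A f :
  {within A, continuous f} <->
  forall x, A x -> forall e, 0 < e ->
    exists2 d, 0 < d & forall y, A y -> `|x - y| < d -> `|f x - f y| < e.
Proof.
split=> [/subspace_continuousP cf x Ax e e0|H].
  have /cvgrPdist_lt/(_ e e0) := cf x Ax.
  rewrite /within/= => -[d /= d0 Hd].
  by exists d => // y Ay xy; apply: Hd.
apply/subspace_continuousP => x Ax; apply/cvgrPdist_lt => e e0.
have [d d0 Hd] := H x Ax e e0.
exists d => //= y xy Ay; exact: Hd.
Qed.

Lemma unit_map_itv f x : unit_map f -> 0 <= x <= 1 -> 0 <= f x <= 1.
Proof. by case=> H _ x01; have := H x; rewrite /= !in_itv/=; apply. Qed.

Lemma unit_map_comp f g : unit_map f -> unit_map g -> unit_map (g \o f).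
Proof.
move=> uf ug; split.
  by move=> x /= /[!in_itv]/= x01; do 2!apply: unit_map_itv => //.
have [_ /within_continuous_epsP cf] := uf.
have [_ /within_continuous_epsP cg] := ug.
apply/within_continuous_epsP => x /= x01 e e0.
have Hf y : `[0, 1]%classic y -> `[0, 1]%classic (f y).
  by rewrite /= !in_itv/= => ?; apply: unit_map_itv.
have [d d0 Hd] := cg _ (Hf _ x01) e e0.
have [d' d'0 Hd'] := cf _ x01 d d0.
by exists d' => // y y01 xy; apply: Hd; [exact: Hf|exact: Hd'].
Qed.

Lemma unit_map_iter f n : unit_map f -> unit_map (iter n f).
Proof.
move=> uf; elim: n => [|n IHn]; last exact: (unit_map_comp IHn uf).
split; first by move=> x.
by apply/within_continuous_epsP => x _ e e0; exists e.
Qed.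

(** An affine map pulls intervals back to intervals, so the pieces of g \o f are
    the sets of points of a piece of f that f sends into a given piece of g;
    being convex, each of them is an interval, namely its own hull. *)
Lemma piecewise_linear_comp f g : unit_map f ->
  piecewise_linear f -> unit_map g -> piecewise_linear g ->
  piecewise_linear (g \o f).
Proof.
move=> uf [_ [s [sU sA]]] ug [_ [t [tU tA]]]; split.
  by case: (unit_map_comp uf ug).
pose J (i j : interval R) := [set x | x \in i /\ f x \in j].
exists [seq Rhull (J i j) | i <- s, j <- t].
have JK i j z : i \in s -> (z \in Rhull (J i j)) <-> J i j z.
  move=> si; have H : [set` Rhull (J i j)] = J i j; last first.
    by have := congr1 (fun A : set R => A z) H; rewrite /= => ->.
  apply: RhullK; rewrite inE => {z} x y [xi fxj] [yi fyj] z /andP[xz zy].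
  have zi : z \in i by apply: (interval_is_interval xi yi); rewrite xz zy.
  split=> //; have [a [b Hab]] := sA _ si.
  have [a0|a0] := leP 0 a.
    apply: (interval_is_interval fxj fyj); rewrite !Hab// !lerD2r.
    by rewrite !ler_wpM2l.
  apply: (interval_is_interval fyj fxj); rewrite !Hab// !lerD2r.
  by rewrite !ler_wnM2l// ltW.
split.
  apply/seteqP; split=> x.
    case=> k /= /allpairsP[[i j] /= [si tj ->]] /=.
    move=> /(JK _ _ _ si)[xi _].
    suff : `[0, 1]%classic x by [].
    by rewrite -sU; exists i.
  move=> x01; have : `[0, 1]%classic (f x).
    by move: x01; rewrite /= !in_itv/=; exact: unit_map_itv.
  move: x01; rewrite -{1}sU -tU => -[i /= si xi] [j /= tj fxj].
  exists (Rhull (J i j)) => /=; first by apply/allpairsP; exists (i, j).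
  exact/JK.
move=> k /allpairsP[[i j] /= [si tj ->]].
have [a [b Hab]] := sA _ si; have [c [d Hcd]] := tA _ tj.
exists (c * a), (c * b + d) => x /(JK _ _ _ si)[xi fxj].
by rewrite /= Hcd// Hab//; ring.
Qed.

Lemma piecewise_linear_iter f n :
  unit_map f -> piecewise_linear f -> piecewise_linear (iter n f).
Proof.
move=> uf pf; elim: n => [|n IHn]; last first.
  exact: (piecewise_linear_comp (unit_map_iter n uf) IHn uf pf).
split; first by have [] := unit_map_iter 0 uf.
exists [:: `[0, 1]]; split; first by rewrite set_cons1 bigcup_set1.
by move=> i _; exists 1, 0 => x _; rewrite /=; ring.
Qed.

(** Each interval of a finite cover either contains or misses a whole right
    neighbourhood of x, since it is convex; a common neighbourhood works for all
    the intervals at once, and one of them must contain it. *)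
Lemma piecewise_linear_right f x : piecewise_linear f -> 0 <= x < 1 ->
  exists a d, [/\ 0 < d, x + d <= 1 &
    forall s, 0 <= s <= d -> f (x + s) = f x + a * s].
Proof.
move=> [/within_continuous_epsP cf [s [sU sA]]] /andP[x0 x1].
have [d [d0 xd Hd]] : exists d, [/\ 0 < d, x + d <= 1 & forall i, i \in s ->
    (forall y, x < y < x + d -> y \in i) \/
    (forall y, x < y < x + d -> y \notin i)].
  elim: s {sU sA} => [|i s [d [d0 xd IHs]]].
    by exists (1 - x); split; [rewrite subr_gt0|lra|].
  have [[e e0 Hi]|nHi] := pselect (exists2 e, 0 < e &
      (forall y, x < y < x + e -> y \in i) \/
      (forall y, x < y < x + e -> y \notin i)).
    exists (Num.min d e); split; first by rewrite lt_min d0 e0.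
      by rewrite (le_trans _ xd)// lerD2l ge_min lexx.
    have Hd : Num.min d e <= d by rewrite ge_min lexx.
    have He : Num.min d e <= e by rewrite ge_min lexx orbT.
    move=> j; rewrite inE => /predU1P[->|/IHs [] Hj].
    - by case: Hi => Hi; [left|right] => y /andP[xy yx]; apply: Hi; lra.
    - by left=> y xy; apply: Hj; lra.
    - by right=> y xy; apply: Hj; lra.
  exfalso; apply: nHi.
  have [[y xy yi]|H] := pselect (exists2 y, x < y < x + d & y \in i);
    last first.
    exists d => //; right=> y xy; apply/negP => yi; apply: H.
    by exists y.
  have [[e e0 He]|H] := pselect (exists2 e, 0 < e &
    forall y, x < y < x + e -> y \notin i); first by exists e => //; right.
  exists (y - x); first lra.
  left=> z xz; have [[w xw wi]|H'] :=
    pselect (exists2 w, x < w < z & w \in i).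
    by apply: (interval_is_interval wi yi); lra.
  exfalso; apply: H; exists (z - x); first lra.
  by move=> w xw; apply/negP => wi; apply: H'; exists w => //; lra.
have : `[0, 1]%classic (x + d / 2) by rewrite /= in_itv/=; lra.
rewrite -sU => -[i /= si xi].
have [a [b Hab]] := sA _ si.
have {}Hd y : x < y < x + d -> f y = a * y + b.
  move=> xy; apply: Hab; case: (Hd _ si); first exact.
  by move=> /(_ (x + d / 2)); rewrite xi; lra.
(* continuity extends the affine formula to the endpoint x *)
have fx : f x = a * x + b.
  apply/eqP; rewrite -subr_eq0; apply/negP => /negP ne0.
  have e0 : 0 < `|f x - (a * x + b)| / 2 by rewrite divr_gt0// normr_gt0.
  have [|r r0 Hr] := cf x _ _ e0; first by rewrite /= in_itv/=; lra.
  have A0 : 0 < 1 + `|a| by have := normr_ge0 a; lra.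
  pose t := Num.min (d / 2) (Num.min (r / 2)
    (`|f x - (a * x + b)| / 2 / (1 + `|a|))).
  have t0 : 0 < t by rewrite !lt_min !divr_gt0// normr_gt0.
  have td : t <= d / 2 by rewrite ge_min lexx.
  have tr : t <= r / 2 by rewrite !ge_min lexx orbT.
  have te : t <= `|f x - (a * x + b)| / 2 / (1 + `|a|).
    by rewrite !ge_min lexx !orbT.
  clearbody t; have {}Hr := Hr (x + t); rewrite (Hd (x + t)) in Hr; last lra.
  have : `|f x - (a * (x + t) + b)| < `|f x - (a * x + b)| / 2.
    apply: Hr; first by rewrite /= in_itv/=; lra.
    by rewrite opprD addrA subrr sub0r normrN gtr0_norm//; lra.
  have : `|a * t| <= `|f x - (a * x + b)| / 2.
    rewrite normrM (gtr0_norm t0); apply: (@le_trans _ _ ((1 + `|a|) * t)).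
      by apply: ler_wpM2r; [exact: ltW|lra].
    by rewrite mulrC -ler_pdivlMr.
  have := ler_normD (f x - (a * (x + t) + b)) (a * t).
  rewrite (_ : f x - (a * (x + t) + b) + a * t = f x - (a * x + b)); last ring.
  lra.
exists a, (d / 2); split; [lra|lra|] => y /andP[y0 yd].
have [->|yn0] := eqVneq y 0; first by rewrite !addr0 mulr0 addr0.
rewrite Hd ?fx; first ring.
by have : 0 < y by [rewrite lt_neqAle eq_sym yn0 y0]; lra.
Qed.

Lemma unit_map_IVT f x y w : unit_map f -> 0 <= x -> x <= y -> y <= 1 ->
  Num.min (f x) (f y) <= w <= Num.max (f x) (f y) ->
  exists2 c, x <= c <= y & f c = w.
Proof.
move=> [_ cf] x0 xy y1 fw.
have [|c] := @IVT R f x y w xy _ fw.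
  apply: continuous_subspaceW cf => z /=; rewrite !in_itv/=; lra.
by rewrite in_itv/=; exists c.
Qed.

End PiecewiseLinear.

(** * Laps of the iterates of a unimodal map *)

(** [unimodal] with its turning point exposed and interval memberships unfolded
    into inequalities. *)
Record unimodal_at (R : realType) (g : R -> R) (v : R) : Prop := UnimodalAt {
  unimodal_unit : unit_map g;
  unimodal_top_itv : 0 < v < 1;
  unimodal_inc : forall x y, 0 <= x -> x < y -> y <= v -> g x < g y;
  unimodal_dec : forall x y, v <= x -> x < y -> y <= 1 -> g y < g x;
  unimodal0 : g 0 = 0;
  unimodal1 : g 1 = 0;
  unimodal_top : g v = 1 }.

Lemma unimodalP (R : realType) (g : R -> R) :
  unimodal g -> exists v, unimodal_at g v.
Proof.
move=> [ug [v [v01 inc dec [g0 g1] gv]]]; exists v; split=> // x y x0 xy yv.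
  by apply: inc => //; rewrite in_itv/=; lra.
by apply: dec => //; rewrite in_itv/=; lra.
Qed.

(** The decreasing branch reverses the order of the knots, so it sends the one
    of index j at level N.+1 to the one of index 2 ^ N.+1 - j at level N. *)
Lemma reflect_le N j : (2 ^ N <= j)%N -> (2 ^ N.+1 - j <= 2 ^ N)%N.
Proof. by rewrite leq_subLR expnS mul2n -addnn leq_add2r. Qed.

Lemma reflect_lt N j :
  (2 ^ N <= j)%N -> (j < 2 ^ N.+1)%N -> (2 ^ N.+1 - j.+1 < 2 ^ N)%N.
Proof. by move=> jN jN1; rewrite subnSK// reflect_le. Qed.

Section Laps.
Variables (R : realType) (g : R -> R) (v : R).
Implicit Types (x y : R) (N i j : nat).

Definition linv y := xget 0 [set x | 0 <= x <= v /\ g x = y].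
Definition rinv y := xget 0 [set x | v <= x <= 1 /\ g x = y].

(** knot N 0 < knot N 1 < ... < knot N (2 ^ N) are the points that the N-th
    iterate of g sends to 0 or 1, i.e. the endpoints of its 2 ^ N laps. They are
    pulled back through the two inverse branches of g, the second half in
    reverse order because g is decreasing there. *)
Fixpoint knot N j : R :=
  if N is N'.+1 then
    if (j <= 2 ^ N')%N then linv (knot N' j)
    else rinv (knot N' (2 ^ N'.+1 - j))
  else j%:R.

Hypothesis G : unimodal_at g v.

Let g_unit : unit_map g. Proof. by case: G. Qed.
Let v01 : 0 < v < 1. Proof. by case: G. Qed.
Let g_inc x y : 0 <= x -> x < y -> y <= v -> g x < g y.
Proof. by case: G => _ _ + _ _ _ _; exact. Qed.
Let g_dec x y : v <= x -> x < y -> y <= 1 -> g y < g x.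
Proof. by case: G => _ _ _ + _ _ _; exact. Qed.
Let g0 : g 0 = 0. Proof. by case: G. Qed.
Let g1 : g 1 = 0. Proof. by case: G. Qed.
Let gv : g v = 1. Proof. by case: G. Qed.

Local Ltac vlra := have := v01 => ?; lra.

Lemma g_mono x y : 0 <= x -> x <= y -> y <= v -> g x <= g y.
Proof.
by move=> x0; rewrite le_eqVlt => /predU1P[->//|xy] yv; exact/ltW/g_inc.
Qed.

Lemma g_anti x y : v <= x -> x <= y -> y <= 1 -> g y <= g x.
Proof.
by move=> vx; rewrite le_eqVlt => /predU1P[->//|xy] y1; exact/ltW/g_dec.
Qed.

Lemma linvP y : 0 <= y <= 1 -> 0 <= linv y <= v /\ g (linv y) = y.
Proof.
move=> y01; rewrite /linv; case: xgetP => [x _ //|/= noinv]; exfalso.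
have [||||x xv gx] := @unit_map_IVT _ g 0 v y g_unit; rewrite ?lexx//; try vlra.
 by rewrite g0 gv minElt maxElt ltr01.
exact: (noinv x).
Qed.

Lemma rinvP y : 0 <= y <= 1 -> v <= rinv y <= 1 /\ g (rinv y) = y.
Proof.
move=> y01; rewrite /rinv; case: xgetP => [x _ //|/= noinv]; exfalso.
have [||||x xv gx] := @unit_map_IVT _ g v 1 y g_unit; rewrite ?lexx//; try vlra.
  by rewrite g1 gv minElt maxElt ltr10.
exact: (noinv x).
Qed.

Lemma g_inj_left x y : 0 <= x <= v -> 0 <= y <= v -> g x = g y -> x = y.
Proof.
by move=> xv yv gxy; case: (ltgtP x y) => // xy;
  [have := @g_inc x y | have := @g_inc y x]; rewrite gxy ltxx; vlra.
Qed.

Lemma g_inj_right x y : v <= x <= 1 -> v <= y <= 1 -> g x = g y -> x = y.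
Proof.
by move=> xv yv gxy; case: (ltgtP x y) => // xy;
  [have := @g_dec x y | have := @g_dec y x]; rewrite gxy ltxx; vlra.
Qed.

Lemma linvK x : 0 <= x <= v -> linv (g x) = x.
Proof.
move=> xv; have [|lv glv] := @linvP (g x).
  by apply: unit_map_itv => //; vlra.
exact: g_inj_left.
Qed.

Lemma rinvK x : v <= x <= 1 -> rinv (g x) = x.
Proof.
move=> xv; have [|lv glv] := @rinvP (g x).
  by apply: unit_map_itv => //; vlra.
exact: g_inj_right.
Qed.

Lemma linv1 : linv 1 = v.
Proof. by rewrite -gv linvK//; vlra. Qed.

Lemma rinv1 : rinv 1 = v.
Proof. by rewrite -gv rinvK//; vlra. Qed.

Lemma linv_lt x y : 0 <= x -> x < y -> y <= 1 -> linv x < linv y.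
Proof.
move=> x0 xy y1; have [|xv gx] := @linvP x; [vlra|].
have [|yv gy] := @linvP y; [vlra|].
rewrite ltNge; apply/negP; rewrite le_eqVlt => /predU1P[e|h].
  by move: xy; rewrite -gx -gy e ltxx.
by have := @g_inc (linv y) (linv x); rewrite gx gy; vlra.
Qed.

Lemma rinv_lt x y : 0 <= x -> x < y -> y <= 1 -> rinv y < rinv x.
Proof.
move=> x0 xy y1; have [|xv gx] := @rinvP x; [vlra|].
have [|yv gy] := @rinvP y; [vlra|].
rewrite ltNge; apply/negP; rewrite le_eqVlt => /predU1P[e|h].
  by move: xy; rewrite -gx -gy e ltxx.
by have := @g_dec (rinv x) (rinv y); rewrite gx gy; vlra.
Qed.

Lemma linv_le x y : 0 <= x -> x <= y -> y <= 1 -> linv x <= linv y.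
Proof.
by move=> x0; rewrite le_eqVlt => /predU1P[->//|xy y1]; apply/ltW/linv_lt.
Qed.

Lemma rinv_le x y : 0 <= x -> x <= y -> y <= 1 -> rinv y <= rinv x.
Proof.
by move=> x0; rewrite le_eqVlt => /predU1P[->//|xy y1]; apply/ltW/rinv_lt.
Qed.

Lemma knot_itv N j : (j <= 2 ^ N)%N -> 0 <= knot N j <= 1.
Proof.
elim: N j => [|N IHN] j /=.
  by rewrite expn0; case: j => [|[|]]//; rewrite ?lexx ?ler01.
rewrite expnS => jN; case: ifP => jN'.
  by have [] := linvP (IHN _ jN'); vlra.
have [|] := @rinvP (knot N (2 * 2 ^ N - j)); last vlra.
by apply: IHN; lia.
Qed.

Lemma knot_linv N j : (j <= 2 ^ N)%N -> knot N.+1 j = linv (knot N j).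
Proof. by move=> /= ->. Qed.

Lemma knot0 N : knot N 0 = 0.
Proof.
by elim: N => [//|N IHN]; rewrite knot_linv// IHN -{1}g0 linvK// lexx; vlra.
Qed.

Lemma knot_top N : knot N (2 ^ N) = 1.
Proof.
case: N => [//|N]; rewrite /= ifF; last first.
  by apply/negbTE; rewrite -ltnNge expnS; have := expn_gt0 2 N; lia.
by rewrite subnn knot0 -g1 rinvK// lexx; vlra.
Qed.

Lemma knot_half N : knot N.+1 (2 ^ N) = v.
Proof. by rewrite knot_linv// knot_top linv1. Qed.

Lemma knot_rinv N j : (2 ^ N <= j)%N ->
  knot N.+1 j = rinv (knot N (2 ^ N.+1 - j)).
Proof.
rewrite leq_eqVlt => /predU1P[<-|jN]; last by rewrite /= leqNgt jN.
by rewrite knot_half expnS mul2n -addnn addnK knot_top rinv1.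
Qed.

Lemma g_knot_left N j : (j <= 2 ^ N)%N -> g (knot N.+1 j) = knot N j.
Proof. by move=> jN; rewrite knot_linv//; have [] := linvP (knot_itv jN). Qed.

Lemma g_knot_right N j : (2 ^ N <= j)%N -> (j <= 2 ^ N.+1)%N ->
  g (knot N.+1 j) = knot N (2 ^ N.+1 - j).
Proof.
move=> jN jN1; rewrite knot_rinv//.
have [|//] := @rinvP (knot N (2 ^ N.+1 - j)).
by apply/knot_itv/reflect_le.
Qed.

Lemma knot_ltS N j : (j < 2 ^ N)%N -> knot N j < knot N j.+1.
Proof.
elim: N j => [|N IHN] j; first by rewrite expn0; case: j.
move=> jN; have [jN'|jN'] := ltnP j (2 ^ N).
  rewrite !knot_linv// 1?ltnW//.
  have /andP[? ?] := knot_itv (ltnW jN'); have /andP[? ?] := knot_itv jN'.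
  by apply: linv_lt => //; exact: IHN.
rewrite !knot_rinv//; last exact: ltnW.
move: jN; rewrite expnS => jN.
have H : (2 * 2 ^ N - j.+1 < 2 ^ N)%N by lia.
have := knot_itv (ltnW H); have := knot_itv H; have := IHN _ H.
rewrite (_ : (2 * 2 ^ N - j.+1).+1 = (2 * 2 ^ N - j)%N); last lia.
by move=> ? /andP[? ?] /andP[? ?]; exact: rinv_lt.
Qed.

Lemma knot_lt N i j : (i < j)%N -> (j <= 2 ^ N)%N -> knot N i < knot N j.
Proof.
elim: j => // j IHj; rewrite ltnS leq_eqVlt => /predU1P[->|ij] jN.
  exact: knot_ltS.
by apply: (lt_trans (IHj ij (ltnW jN))); exact: knot_ltS.
Qed.

Lemma knot_le N i j : (i <= j)%N -> (j <= 2 ^ N)%N -> knot N i <= knot N j.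
Proof.
by rewrite leq_eqVlt => /predU1P[->//|ij] jN; apply/ltW/knot_lt.
Qed.

Lemma knot_inj N i j : (i <= 2 ^ N)%N -> (j <= 2 ^ N)%N ->
  knot N i = knot N j -> i = j.
Proof.
move=> iN jN e; have [ij|ji|//] := ltngtP i j.
  by have := knot_lt ij jN; rewrite e ltxx.
by have := knot_lt ji iN; rewrite e ltxx.
Qed.

(** An endpoint of a lap of the N-th iterate is one of the next iterate as well,
    with its index doubled, because every lap is folded exactly once. *)
Lemma knot_double N j : (j <= 2 ^ N)%N -> knot N.+1 j.*2 = knot N j.
Proof.
elim: N j => [|N IHN] j jN.
  move: jN; rewrite expn0; case: j => [|[|]]// _; first exact: knot0.
  exact: knot_top 1.
have [jN'|jN'] := leqP j (2 ^ N).
  rewrite knot_linv ?IHN -?knot_linv//; rewrite expnS; lia.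
have e : (2 ^ N.+2 - j.*2 = (2 ^ N.+1 - j).*2)%N by rewrite !expnS; lia.
rewrite knot_rinv ?e; last by rewrite expnS; lia.
rewrite IHN; last by move: jN jN'; rewrite !expnS; lia.
by rewrite -knot_rinv// ltnW.
Qed.

Lemma iter_knot N j : (j <= 2 ^ N)%N -> iter N g (knot N j) = (odd j)%:R.
Proof.
elim: N j => [|N IHN] j; first by rewrite expn0; case: j => [|[|]].
move=> jN; rewrite iterSr; have [jN'|jN'] := leqP j (2 ^ N).
  by rewrite g_knot_left// IHN.
rewrite g_knot_right// 1?ltnW// IHN; last first.
  by apply: reflect_le; exact: ltnW.
by rewrite oddB// expnS oddM.
Qed.

Lemma iter_itv N x : 0 <= x <= 1 -> 0 <= iter N g x <= 1.
Proof. by apply: unit_map_itv; exact: unit_map_iter. Qed.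

Lemma knotP N x : 0 <= x <= 1 -> iter N g x = 0 \/ iter N g x = 1 ->
  exists2 j, (j <= 2 ^ N)%N & x = knot N j.
Proof.
elim: N x => [|N IHN] x x01; first by case=> /= ->; [exists 0%N|exists 1%N].
rewrite iterSr => /IHN[|j jN gx]; first exact: unit_map_itv.
have [xv|vx] := leP x v.
  exists j; first by rewrite expnS; lia.
  by rewrite knot_linv// -gx linvK//; vlra.
exists (2 ^ N.+1 - j)%N; first by rewrite leq_subr.
have jN' : (j <= 2 ^ N.+1)%N by rewrite expnS; lia.
rewrite knot_rinv; last by rewrite expnS; lia.
by rewrite subKn// -gx rinvK//; vlra.
Qed.

Lemma lap_exists N x : 0 <= x <= 1 ->
  exists2 j, (j < 2 ^ N)%N & knot N j <= x <= knot N j.+1.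
Proof.
move=> /andP[x0 x1].
have ex : exists j, (j <= 2 ^ N)%N && (x <= knot N j).
  by exists (2 ^ N)%N; rewrite leqnn knot_top.
case: (ex_minnP ex) => [[|j]] /andP[jN xj] jmin.
  exists 0%N; first by rewrite expn_gt0.
  rewrite knot0 x0/= (le_trans xj)// knot_le//.
  by rewrite expn_gt0.
exists j => //; rewrite xj andbT leNgt; apply/negP => xj'.
by have := jmin j; rewrite (ltnW jN) ltW//= => /(_ isT); rewrite ltnn.
Qed.

(** Laps of consecutive iterates correspond under g; this and the next lemma
    carry the inductions on the number of iterations. *)
Lemma lap_left N j x : (j < 2 ^ N)%N -> knot N.+1 j <= x <= knot N.+1 j.+1 ->
  0 <= x <= v /\ knot N j <= g x <= knot N j.+1.
Proof.
move=> jN; rewrite !knot_linv//; last exact: ltnW.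
have kj := knot_itv (ltnW jN); have kj1 := knot_itv jN.
have [? e] := linvP kj; have [? e1] := linvP kj1 => xj.
have xv : 0 <= x <= v by vlra.
split=> //; rewrite -[X in X <= _]e -[X in _ && (_ <= X)]e1.
by rewrite !g_mono//; vlra.
Qed.

Lemma lap_right N j x : (2 ^ N <= j)%N -> (j < 2 ^ N.+1)%N ->
  knot N.+1 j <= x <= knot N.+1 j.+1 ->
  v <= x <= 1 /\ knot N (2 ^ N.+1 - j.+1) <= g x <= knot N (2 ^ N.+1 - j.+1).+1.
Proof.
move=> jN jN1; rewrite subnSK//.
have kj : 0 <= knot N (2 ^ N.+1 - j) <= 1.
  exact/knot_itv/reflect_le.
have kj1 : 0 <= knot N (2 ^ N.+1 - j.+1) <= 1.
  by apply/knot_itv/ltnW/reflect_lt.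
rewrite !knot_rinv// ?(leq_trans jN)//.
have [? e] := rinvP kj; have [? e1] := rinvP kj1 => xj.
have xv : v <= x <= 1 by vlra.
split=> //; rewrite -[X in X <= _]e1 -[X in _ && (_ <= X)]e.
by rewrite !g_anti//; vlra.
Qed.

Lemma lap_inj N j x y : (j < 2 ^ N)%N ->
  knot N j <= x <= knot N j.+1 -> knot N j <= y <= knot N j.+1 ->
  iter N g x = iter N g y -> x = y.
Proof.
elim: N j x y => [//|N IHN] j x y jN1 xj yj; rewrite !iterSr => e.
have [jN|jN] := ltnP j (2 ^ N).
  have [xv gx] := lap_left jN xj; have [yv gy] := lap_left jN yj.
  by apply: g_inj_left => //; exact: (IHN j).
have [xv gx] := lap_right jN jN1 xj; have [yv gy] := lap_right jN jN1 yj.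
apply: g_inj_right => //.
exact: (IHN _ _ _ (reflect_lt jN jN1) gx gy e).
Qed.

Lemma lap_surj N j w : (j < 2 ^ N)%N -> 0 <= w <= 1 ->
  exists2 x, knot N j <= x <= knot N j.+1 & iter N g x = w.
Proof.
elim: N j => [|N IHN] j jN1 w01.
  by exists w => //; move: jN1; rewrite expn0; case: j.
have [jN|jN] := ltnP j (2 ^ N).
  have [x xj gx] := IHN _ jN w01.
  have := knot_itv (ltnW jN); have := knot_itv jN => kj1 kj.
  have x01 : 0 <= x <= 1 by vlra.
  exists (linv x); last by rewrite iterSr; have [_ ->] := linvP x01.
  rewrite !knot_linv// ?linv_le//; try vlra.
  exact: ltnW.
have jN' : (2 ^ N.+1 - j.+1 < 2 ^ N)%N by exact: reflect_lt.
have [x xj gx] := IHN _ jN' w01.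
have := knot_itv (ltnW jN'); have := knot_itv jN' => kj1 kj.
have x01 : 0 <= x <= 1 by vlra.
exists (rinv x); last by rewrite iterSr; have [_ ->] := rinvP x01.
move: xj kj1; rewrite subnSK// => xj kj1.
by rewrite !knot_rinv// ?rinv_le//; try vlra; rewrite (leq_trans jN).
Qed.

Lemma first_lap_inc N x y : 0 <= x -> x < y -> y <= knot N 1 ->
  iter N g x < iter N g y.
Proof.
elim: N x y => [//|N IHN] x y x0 xy.
have k1 := @knot_itv N 1; rewrite expn_gt0 in k1.
rewrite knot_linv ?expn_gt0// => y1.
have [lv gl] := linvP (k1 isT).
rewrite !iterSr; apply: IHN.
- by rewrite -g0 g_mono//; vlra.
- by apply: g_inc; vlra.
- by rewrite -gl g_mono//; vlra.
Qed.

Lemma knot_pow2 N i j : (j <= 2 ^ N)%N -> knot (i + N) (2 ^ i * j) = knot N j.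
Proof.
move=> jN; elim: i => [|i IHi]; first by rewrite mul1n.
by rewrite addSn expnS -mulnA mul2n knot_double// expnD leq_pmul2l// expn_gt0.
Qed.

Lemma iter_knot_left m N j : (j <= 2 ^ N)%N ->
  iter m g (knot (m + N) j) = knot N j.
Proof.
move=> jN; elim: m => [//|m IHm]; rewrite iterSr addSn g_knot_left//.
by rewrite (leq_trans jN)// leq_exp2l// leq_addl.
Qed.

End Laps.

(** * Sequences homogeneous for two multiplications *)

Section Growth.
Variable R : realType.
Implicit Types (x y a b c : R) (i j m n : nat).

Lemma expr_unbounded c b : 1 < c -> exists n, b < c ^+ n.
Proof.
move=> c1; have bernoulli n : 1 + n%:R * (c - 1) <= c ^+ n.
  elim: n => [|n IHn]; first by rewrite mul0r addr0 expr0.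
  rewrite exprS; apply: (@le_trans _ _ (c * (1 + n%:R * (c - 1)))).
    rewrite -subr_ge0 -natr1.
    have : 0 <= n%:R * (c - 1) ^+ 2 by rewrite mulr_ge0 ?sqr_ge0 ?ler0n.
    by rewrite expr2; nra.
  by rewrite ler_wpM2l//; lra.
exists (Num.truncn (b / (c - 1))).+1; apply: lt_le_trans (bernoulli _).
have : b / (c - 1) < (Num.truncn (b / (c - 1))).+1%:R := truncnS_gt _.
by rewrite ltr_pdivrMr ?subr_gt0//; lra.
Qed.

Lemma powR_log2 a : 0 < a -> 2 `^ (ln a / ln 2) = a.
Proof.
move=> a0; have l2 : 0 < ln (2 : R) by rewrite ln_gt0// ltr1n.
apply: ln_inj; rewrite ?posrE ?powR_gt0// ln_powR.
by rewrite divfK// gt_eqF.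
Qed.

Lemma powRX x y n : 0 <= x -> (x ^+ n) `^ y = (x `^ y) ^+ n.
Proof.
move=> x0; rewrite -powR_mulrn// -powRrM mulrC powRrM powR_mulrn//.
exact: powR_ge0.
Qed.

(** When M is not a power of 2 the numbers 2 ^ i * M ^ j have quotients
    arbitrarily close to 1: the mantissas M ^ j / 2 ^ trunc_log 2 (M ^ j) lie in
    [1, 2) and are pairwise distinct, so by the pigeonhole principle two of them
    are as close as desired. *)
Lemma close_products M (e : R) : (0 < M)%N -> (forall r, M <> 2 ^ r)%N ->
  1 < e -> exists i j i' j',
    (2 ^ i * M ^ j < 2 ^ i' * M ^ j')%N /\
    (2 ^ i' * M ^ j')%:R < e * (2 ^ i * M ^ j)%:R.
Proof.
move=> M0 M2 e1.
have M_gt1 : (1 < M)%N.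
  by case: M M0 M2 => [|[|M]]// _ /(_ 0%N); rewrite expn0.
have Mj0 j : (0 < M ^ j)%N by rewrite expn_gt0 M0.
pose l j := trunc_log 2 (M ^ j).
have lP j : (2 ^ l j <= M ^ j < 2 * 2 ^ l j)%N.
  by rewrite -expnS; exact: trunc_log_bounds.
pose u j : R := (M ^ j)%:R / (2 ^ l j)%:R.
have p0 i : 0 < (2 ^ i)%:R :> R by rewrite ltr0n expn_gt0.
have uP j : 1 <= u j < 2.
  have /andP[l1 l2] := lP j.
  rewrite /u ler_pdivlMr// mul1r ltr_pdivrMr// ler_nat l1/=.
  by rewrite -natrM ltr_nat.
pose N := (Num.truncn (e - 1)^-1).+1.
have N0 : 0 < N%:R :> R by rewrite ltr0n.
have Ne : N%:R^-1 < e - 1.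
  rewrite -[ltRHS]invrK ltf_pV2 ?posrE ?invr_gt0//; last lra.
  exact: truncnS_gt.
have cellP j : (Num.truncn (N%:R * (u j - 1)) < N)%N.
  have /andP[u1 u2] := uP j; rewrite truncn_lt_nat.
    by rewrite -[ltRHS]mulr1 ltr_pM2l//; lra.
  by rewrite mulr_ge0//; lra.
pose cell (j : 'I_N.+1) : 'I_N := Ordinal (cellP j).
have [j [j' [jj' cjj']]] : exists j j' : 'I_N.+1, j <> j' /\ cell j = cell j'.
  have [inj|] := pselect (injective cell).
    by have := leq_card cell inj; rewrite !card_ord ltnn.
  by move=> ninj; apply: contrapT => H; apply: ninj => j j' cjj';
     apply: contrapT => jj'; apply: H; exists j, j'.
have close (s t : nat) : Num.truncn (N%:R * (u s - 1)) =
    Num.truncn (N%:R * (u t - 1)) -> u s < e * u t.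
  move=> st; have /andP[s1 s2] := uP s; have /andP[t1 t2] := uP t.
  have /truncn_itv/andP[_] : 0 <= N%:R * (u s - 1) by rewrite mulr_ge0//; lra.
  have /truncn_itv/andP[+ _] : 0 <= N%:R * (u t - 1) by rewrite mulr_ge0//; lra.
  rewrite st; move: (Num.truncn _) => q h1; rewrite -natr1 => h2.
  have : N%:R * (u s - u t) < N%:R * N%:R^-1 by rewrite divff ?gt_eqF//; lra.
  rewrite ltr_pM2l// => h3.
  have : (e - 1) * 1 <= (e - 1) * u t by rewrite ler_pM2l//; lra.
  lra.
have clear_denom s t : u s < e * u t ->
    (2 ^ l t * M ^ s)%:R < e * (2 ^ l s * M ^ t)%:R.
  rewrite /u mulrA ltr_pdivrMr// mulrAC ltr_pdivlMr// !natrM; lra.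
have distinct (s t : nat) : (s < t)%N ->
    (2 ^ l t * M ^ s)%N <> (2 ^ l s * M ^ t)%N.
  move=> st; have -> : (M ^ t = M ^ (t - s) * M ^ s)%N.
    by rewrite -expnD subnK// ltnW.
  rewrite mulnA => /eqP.
  rewrite eqn_pmul2r// => /eqP E.
  have : (M %| 2 ^ l t)%N by rewrite E dvdn_mull// dvdn_exp// subn_gt0.
  by move=> /(@dvdn_pfactor 2)[]// r _; exact: M2.
have {distinct}D : (2 ^ l j' * M ^ j)%N <> (2 ^ l j * M ^ j')%N.
  have [?|?|/val_inj//] := ltngtP (val j) (val j'); first exact: distinct.
  by move/esym; exact: distinct.
have cv : Num.truncn (N%:R * (u j - 1)) = Num.truncn (N%:R * (u j' - 1)).
  exact: (congr1 val cjj').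
have [lt|lt|//] := ltngtP (2 ^ l j' * M ^ j)%N (2 ^ l j * M ^ j')%N.
  by exists (l j'), j, (l j), j'; split=> //; apply/clear_denom/close.
by exists (l j), j', (l j'), j; split=> //; apply/clear_denom/close.
Qed.

(** A monotone sequence that is homogeneous for the multiplication by two
    multiplicatively independent integers is a power. The quotient phi of z n by
    the power predicted by the first homogeneity is bounded, hence invariant
    under both multiplications; since the quotients of products of 2 and M are
    dense, any two indices can be brought arbitrarily close to each other
    without changing phi, and monotonicity of z then makes phi constant. *)
Lemma power_law (z : nat -> R) a k M : 1 < a ->
  (forall n, (0 < n)%N -> 0 < z n) ->
  (forall m n, (0 < m)%N -> (m < n)%N -> z m < z n) ->
  (forall n, (0 < n)%N -> z (2 * n)%N = a * z n) ->
  (forall n, (0 < n)%N -> z (M * n)%N = k * z n) ->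
  (0 < M)%N -> (forall r, M <> 2 ^ r)%N ->
  forall n, (0 < n)%N -> z n = z 1%N * n%:R `^ (ln a / ln 2).
Proof.
move=> a1 z0 zlt z2 zM M0 Mpow; set al := ln a / ln 2.
have a0 : 0 < a by lra.
have al0 : 0 < al by rewrite divr_gt0 ?ln_gt0// ltr1n.
have al2 : 2 `^ al = a := powR_log2 a0.
have zle m n : (0 < m)%N -> (m <= n)%N -> z m <= z n.
  by move=> m0; rewrite leq_eqVlt => /predU1P[->//|mn]; exact/ltW/zlt.
have pow0 n : (0 < n)%N -> 0 < n%:R `^ al.
  by move=> n0; rewrite powR_gt0// ltr0n.
have powM m n : (m * n)%:R `^ al = m%:R `^ al * n%:R `^ al.
  by rewrite natrM powRM.
have pow_le m n : (m <= n)%N -> m%:R `^ al <= n%:R `^ al.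
  by move=> mn; rewrite ge0_ler_powR ?nnegrE// ?ler_nat// ltW.
have z2X i n : (0 < n)%N -> z (2 ^ i * n)%N = a ^+ i * z n.
  move=> n0; elim: i => [|i IHi]; first by rewrite expr0 mul1r mul1n.
  by rewrite expnS -mulnA z2 ?muln_gt0 ?expn_gt0// IHi exprS mulrA.
have pow2 i : (2 ^ i)%:R `^ al = a ^+ i by rewrite natrX powRX// al2.
pose phi n := z n / n%:R `^ al.
have phi0 n : (0 < n)%N -> 0 < phi n by move=> n0; rewrite divr_gt0 ?z0 ?pow0.
have phi2 i n : (0 < n)%N -> phi (2 ^ i * n)%N = phi n.
  move=> n0; rewrite /phi z2X// powM pow2 invfM mulrACA divff ?mul1r//.
  by rewrite gt_eqF// exprn_gt0.
(* between consecutive powers of 2 phi varies by at most the factor a *)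
have phi_bound n : (0 < n)%N -> z 1%N / a <= phi n <= a * z 1%N.
  move=> n0; have := @trunc_log_bounds 2 n isT n0 => /=.
  set i := trunc_log 2 n => /andP[in1 in2].
  have ai0 : 0 < a ^+ i by rewrite exprn_gt0.
  have zi : z (2 ^ i)%N = a ^+ i * z 1%N by rewrite -z2X// muln1.
  have zi1 : z (2 ^ i.+1)%N = a * a ^+ i * z 1%N by rewrite -exprS -z2X// muln1.
  have h1 := zle _ _ _ in1; rewrite expn_gt0 zi in h1.
  have h2 := zle _ _ n0 (ltnW in2); rewrite zi1 in h2.
  have p1 := pow_le _ _ in1; rewrite pow2 in p1.
  have p2 := pow_le _ _ (ltnW in2); rewrite pow2 exprS in p2.
  rewrite /phi ler_pdivrMr// mulrAC ler_pdivlMr ?pow0// ler_pdivrMr ?pow0//.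
  have z10 := z0 1%N isT; apply/andP; split.
    apply: (@le_trans _ _ (z 1%N * (a * a ^+ i))); first by rewrite ler_pM2l.
    by rewrite mulrCA mulrC ler_pM2r// mulrC h1.
  apply: (le_trans h2); rewrite -mulrA [a ^+ i * _]mulrC mulrA ler_pM2l//.
  by rewrite mulr_gt0.
have Mal : 0 < M%:R `^ al := pow0 _ M0.
have k0 : 0 < k.
  have := z0 (M * 1)%N; rewrite zM// muln1 => /(_ M0).
  by rewrite pmulr_lgt0// z0.
pose q := k / M%:R `^ al.
have q0 : 0 < q by rewrite divr_gt0.
have phiM n : (0 < n)%N -> phi (M * n)%N = q * phi n.
  by move=> n0; rewrite /phi /q zM// powM invfM mulrACA.
have phiMX j n : (0 < n)%N -> phi (M ^ j * n)%N = q ^+ j * phi n.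
  move=> n0; elim: j => [|j IHj]; first by rewrite expr0 mul1r mul1n.
  by rewrite expnS -mulnA phiM ?muln_gt0 ?expn_gt0 ?M0// IHj exprS mulrA.
(* a bounded geometric progression has ratio 1 *)
have q1 : q = 1.
  have z10 := z0 1%N isT.
  have phi1 : phi 1%N = z 1%N by rewrite /phi powR1 divr1.
  have B j : a^-1 <= q ^+ j <= a.
    have := phi_bound (M ^ j * 1)%N; rewrite muln_gt0 expn_gt0 M0/= => /(_ isT).
    rewrite phiMX// phi1 ler_pM2r// => /andP[h ->]; rewrite andbT.
    by move: h; rewrite mulrC ler_pM2r.
  apply/eqP; rewrite eq_le; apply/andP; split; rewrite leNgt; apply/negP => h.
    by have [j] := expr_unbounded a h; rewrite ltNge; have /andP[_ ->] := B j.
  have h' : 1 < q^-1 by rewrite invf_gt1.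
  have [j] := expr_unbounded a h'; rewrite exprVn => aj.
  have /andP[+ _] := B j; rewrite -[X in _ <= X]invrK.
  rewrite lef_pV2 ?posrE ?invr_gt0 ?exprn_gt0//.
  by rewrite leNgt aj.
have phi2M i j n : (0 < n)%N -> phi (2 ^ i * M ^ j * n)%N = phi n.
  move=> n0; rewrite -mulnA phi2 ?muln_gt0 ?expn_gt0 ?M0//.
  by rewrite phiMX// q1 expr1n mul1r.
have mono m n : (0 < m)%N -> (m <= n)%N -> phi n <= phi m.
  move=> m0 mn; have n0 : (0 < n)%N := leq_trans m0 mn.
  rewrite leNgt; apply/negP => lt_phi.
  pose rho := phi n / phi m.
  have rho1 : 1 < rho by rewrite ltr_pdivlMr ?phi0// mul1r.
  pose e := ((1 + rho) / 2) `^ al^-1.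
  have eal : e `^ al = (1 + rho) / 2.
    rewrite -powRrM mulVf ?gt_eqF// powRr1//; lra.
  have e1 : 1 < e.
    apply: (@le_lt_trans _ _ (1 `^ al^-1)); first by rewrite powR1.
    rewrite gt0_ltr_powR ?nnegrE ?invr_gt0//; lra.
  have [i [j [i' [j' []]]]] := close_products M0 Mpow e1.
  set B := (2 ^ i * M ^ j)%N; set A := (2 ^ i' * M ^ j')%N => BA Ae.
  have B0 : (0 < B)%N by rewrite muln_gt0 !expn_gt0 M0.
  have A0 : (0 < A)%N by rewrite muln_gt0 !expn_gt0 M0.
  have phiA t (c : nat) : (0 < c)%N -> phi (A ^ t * c)%N = phi c.
    move=> c0; elim: t => [|t IHt]; first by rewrite mul1n.
    by rewrite expnS -mulnA phi2M ?muln_gt0 ?expn_gt0 ?A0.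
  have phiB t (c : nat) : (0 < c)%N -> phi (B ^ t * c)%N = phi c.
    move=> c0; elim: t => [|t IHt]; first by rewrite mul1n.
    by rewrite expnS -mulnA phi2M ?muln_gt0 ?expn_gt0 ?B0.
  have ex : exists t, (B ^ t * n <= A ^ t * m)%N.
    have AB1 : 1 < A%:R / B%:R :> R.
      by rewrite ltr_pdivlMr ?ltr0n// mul1r ltr_nat.
    have [t] := expr_unbounded (n%:R / m%:R) AB1.
    rewrite ltr_pdivrMr ?ltr0n// expr_div_n mulrAC ltr_pdivlMr; last first.
      by rewrite exprn_gt0// ltr0n.
    rewrite -!natrX -!natrM ltr_nat => h; exists t.
    by rewrite mulnC ltnW.
  case: (ex_minnP ex) => t tP tmin.
  have Bt0 : (0 < B ^ t * n)%N by rewrite muln_gt0 expn_gt0 B0.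
  have At0 : (0 < A ^ t * m)%N by rewrite muln_gt0 expn_gt0 A0.
  have close : (A ^ t * m)%:R <= e * (B ^ t * n)%:R.
    case: t tmin tP {Bt0 At0} => [_ _|t tmin _].
      rewrite !mul1n; apply: (@le_trans _ _ n%:R); first by rewrite ler_nat.
      by rewrite ler_peMl// ltW.
    have lt : (A ^ t * m <= B ^ t * n)%N.
      by rewrite leqNgt; apply/negP => /ltnW/tmin; rewrite ltnn.
    rewrite !expnS -(mulnA A) -(mulnA B) (natrM _ A) (natrM _ B) mulrA.
    by apply: ler_pM; rewrite ?ler0n ?ler_nat// ltW.
  have := zle _ _ Bt0 tP.
  have zphi (c : nat) : (0 < c)%N -> z c = phi c * c%:R `^ al.
    by move=> c0; rewrite /phi divfK// gt_eqF// pow0.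
  rewrite !zphi// phiA// phiB// leNgt => /negP; apply.
  apply: (@le_lt_trans _ _ (phi m * (e `^ al * (B ^ t * n)%:R `^ al))).
    rewrite ler_pM2l ?phi0// -powRM//; last by rewrite ltW// (lt_trans _ e1).
    rewrite ge0_ler_powR ?nnegrE//; first exact: ltW.
    by rewrite mulr_ge0// ltW// (lt_trans _ e1).
  rewrite mulrA ltr_pM2r ?pow0// eal.
  have -> : phi n = phi m * rho by rewrite mulrC divfK// gt_eqF// phi0.
  by rewrite ltr_pM2l ?phi0//; lra.
have const m n : (0 < m)%N -> (0 < n)%N -> phi n <= phi m.
  move=> m0 n0; rewrite -(phi2 m n)//; apply: mono => //.
  by rewrite (leq_trans (ltnW (ltn_expl m (isT : 1 < 2)%N)))// leq_pmulr.
move=> n n0; have -> : z 1%N = phi n.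
  have <- : phi 1%N = z 1%N by rewrite /phi powR1 divr1.
  by apply/eqP; rewrite eq_le !const.
by rewrite divfK// gt_eqF// pow0.
Qed.

Lemma powR_MVT x y (al : R) : 0 < x -> x < y ->
  exists2 c, x < c < y & y `^ al - x `^ al = al * c `^ (al - 1) * (y - x).
Proof.
move=> x0 xy.
have D c : x <= c -> is_derive c 1 (fun t => t `^ al) (al * c `^ (al - 1)).
  by move=> xc; apply: is_derive1_powR; exact: lt_le_trans xc.
have [||] := @MVT _ (fun t => t `^ al) (fun c => al * c `^ (al - 1)) x y xy.
- by move=> c; rewrite in_itv/= => /andP[xc _]; apply/D/ltW.
- apply: derivable_within_continuous => c; rewrite in_itv/= => /andP[xc _].
  by case: (D c xc).
- by move=> c; rewrite in_itv/= => cxy e; exists c.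
Qed.

(** The mean value theorem turns the increment of x ^ al at 2 ^ i into
    al * xi ^ (al - 1) with xi between 2 ^ i and 2 ^ i + 1. It is thus smaller
    than (2 ^ i) ^ al by a factor of order 2 ^ i, which rules out p > 0; and if
    the increments at two different places agree then al = 1. *)
Lemma increments_rigid (al be p c : R) I : 0 < al -> 0 <= p -> 0 < c ->
  (forall i, (I <= i)%N ->
    be * ((2 ^ i + 1)%:R `^ al - (2 ^ i)%:R `^ al) = p * (2 `^ al) ^+ i + c) ->
  p = 0 /\ al = 1.
Proof.
move=> al0 p0 c0 H.
have a0 : 0 < 2 `^ al by rewrite powR_gt0.
have pow2_gt0 i : 0 < (2 ^ i)%:R :> R by rewrite ltr0n expn_gt0.
have pow2E i : (2 ^ i)%:R `^ al = (2 `^ al) ^+ i by rewrite natrX powRX.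
have mvt i : exists2 xi : R, (2 ^ i)%:R < xi < (2 ^ i + 1)%:R &
    (2 ^ i + 1)%:R `^ al - (2 ^ i)%:R `^ al = al * xi `^ (al - 1).
  have [|xi xiP e] := @powR_MVT (2 ^ i)%:R (2 ^ i + 1)%:R al (pow2_gt0 i).
    by rewrite ltr_nat addn1.
  by exists xi => //; rewrite e natrD addrAC subrr add0r mulr1.
have be0 : 0 < be.
  have := H _ (leqnn I); have [xi /andP[x1 x2] ->] := mvt I => e.
  have : 0 < be * (al * xi `^ (al - 1)).
    by rewrite e ltr_wpDl// mulr_ge0// exprn_ge0// ltW.
  by rewrite pmulr_lgt0// mulr_gt0// powR_gt0// (lt_trans _ x1).
have p_eq0 : p = 0.
  apply/eqP; rewrite eq_le p0 andbT leNgt; apply/negP => p_gt0.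
  have [i hi] := @expr_unbounded 2 (be * al * 2 `^ al / p) (ltr1n _ _).
  have {}hi : be * al * 2 `^ al / p < (2 ^ (i + I))%:R.
    apply: (lt_le_trans hi); rewrite -natrX ler_nat leq_exp2l//.
    exact: leq_addr.
  have := H _ (leq_addl i I); move: (i + I)%N hi => {}i hi.
  have [xi /andP[x1 x2] ->] := mvt i => e.
  have xi0 : 0 < xi := lt_trans (pow2_gt0 i) x1.
  have h1 : xi `^ (al - 1) * (2 ^ i)%:R <= 2 `^ al * (2 `^ al) ^+ i.
    apply: (@le_trans _ _ (xi `^ (al - 1) * xi)).
      by rewrite ler_pM2l ?powR_gt0// ltW.
    rewrite -[X in _ * X](powRr1 (ltW xi0)) -powRD; last first.
      by rewrite (gt_eqF xi0) implybT.
    rewrite subrK.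
    rewrite -pow2E -powRM// ge0_ler_powR ?nnegrE ?mulr_ge0// ?ltW//.
    rewrite (lt_le_trans x2)// -natrM ler_nat mul2n -addnn leq_add2l.
    by rewrite expn_gt0.
  move: hi; rewrite ltr_pdivrMr// => hi.
  have : be * al * (2 `^ al * (2 `^ al) ^+ i) < (2 ^ i)%:R * p * (2 `^ al) ^+ i.
    by rewrite mulrA ltr_pM2r// exprn_gt0.
  have : be * al * (xi `^ (al - 1) * (2 ^ i)%:R) <=
      be * al * (2 `^ al * (2 `^ al) ^+ i).
    by rewrite ler_pM2l// mulr_gt0.
  rewrite [X in X <= _](_ : _ = (p * (2 `^ al) ^+ i + c) * (2 ^ i)%:R);
    last by rewrite -e; ring.
  have : 0 < c * (2 ^ i)%:R by rewrite mulr_gt0.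
  lra.
split=> //.
have [x /andP[x1 x2] ex] := mvt I; have [y /andP[y1 y2] ey] := mvt I.+1.
have x0 := lt_trans (pow2_gt0 _) x1; have y0 := lt_trans (pow2_gt0 _) y1.
have xy : x < y.
  apply: (lt_trans x2); apply: le_lt_trans y1.
  by rewrite ler_nat expnS mul2n -addnn leq_add2l expn_gt0.
have : p * (2 `^ al) ^+ I.+1 + c = p * (2 `^ al) ^+ I + c.
  by rewrite p_eq0 !mul0r.
rewrite -(H _ (leqnSn I)) -(H _ (leqnn I)) ex ey.
move=> /(mulfI (lt0r_neq0 be0))/(mulfI (lt0r_neq0 al0)) e.
apply/eqP; rewrite -subr_eq0; apply/negPn/negP => al1.
have := congr1 (@ln R) e; rewrite !ln_powR => /(mulfI al1)/ln_inj.
by rewrite !posrE => /(_ y0 x0) yx; move: xy; rewrite yx ltxx.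
Qed.

Lemma increments_small (al e : R) : 0 < al -> 0 < e ->
  exists I, forall i, (I <= i)%N ->
  (2 ^ i + 1)%:R `^ al - (2 ^ i)%:R `^ al <= e * (2 `^ al) ^+ i.
Proof.
move=> al0 e0; pose b := (1 + e) `^ al^-1.
have bal : b `^ al = 1 + e by rewrite -powRrM mulVf ?gt_eqF// powRr1//; lra.
have b1 : 1 < b.
  apply: (@le_lt_trans _ _ (1 `^ al^-1)); first by rewrite powR1.
  rewrite gt0_ltr_powR ?nnegrE ?invr_gt0//; lra.
have [I hI] := @expr_unbounded 2 (b - 1)^-1 (ltr1n _ _).
exists I => i Ii; have {}hI : (b - 1)^-1 <= (2 ^ i)%:R.
  by rewrite natrX (le_trans (ltW hI))// ler_weXn2l// ler1n.
have hb : (2 ^ i + 1)%:R <= b * (2 ^ i)%:R.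
  have : (b - 1) * (b - 1)^-1 <= (b - 1) * (2 ^ i)%:R.
    by rewrite ler_pM2l//; lra.
  by rewrite divff ?natrD; [lra|rewrite gt_eqF//; lra].
have : (2 ^ i + 1)%:R `^ al <= (b * (2 ^ i)%:R) `^ al.
  by rewrite ge0_ler_powR ?nnegrE// ?mulr_ge0//; lra.
by rewrite powRM//; [rewrite bal natrX powRX//; lra|lra].
Qed.

End Growth.

(** * The repelling fixed point and its linearising coordinate *)

(** The width d of the range where g is affine belongs to the data because the
    coordinates of knots make sense in [p, p + d] only. *)
Record repelling (R : realType) (g : R -> R) (v p a d : R) : Prop := Repelling {
  repelling_ge0 : 0 <= p;
  repelling_width : 0 < d;
  repelling_left : p + d <= v;
  repelling_slope : 1 < a;
  repelling_fixed : g p = p;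
  repelling_affine : forall s, 0 <= s <= d -> g (p + s) = p + a * s;
  repelling_above : forall x, p < x -> x <= v -> x < g x }.

Section Repelling.
Variables (R : realType) (g : R -> R) (v : R).
Hypothesis G : unimodal_at g v.

(** Take the supremum of the points of [0, v] that g does not move to the right:
    the slope on its right exceeds 1 since g is affine there and moves every
    point to the right. *)
Lemma repelling_exists : piecewise_linear g ->
  exists p a d, repelling g v p a d.
Proof.
move=> pl; have [ug v01 inc dec g0 g1 gv] := G.
pose E := [set x | 0 <= x <= v /\ g x <= x].
have E0 : E 0 by split; rewrite ?g0//; lra.
have hasE : has_sup E by split; [exists 0|exists v => x [/andP[]]].
pose p := sup E.
have Ep x : E x -> x <= p by move=> Ex; apply: ub_le_sup => //; case: hasE.
have p0 : 0 <= p := Ep _ E0.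
have pv : p <= v by apply: ge_sup; [exists 0|move=> x [/andP[]]].
have above x : p < x -> x <= v -> x < g x.
  move=> px xv; rewrite ltNge; apply/negP => gx.
  by have : x <= p; [apply: Ep; split=> //; lra|lra].
have p01 : 0 <= p < 1 by lra.
have [a [d [d0 pd Hd]]] := piecewise_linear_right pl p01.
have gp_le : g p <= p.
  rewrite leNgt; apply/negP => gp.
  have [/within_continuous_epsP cg _] := pl.
  have Ip : `[0, 1]%classic p by rewrite /= in_itv/=; lra.
  have e0 : 0 < g p - p by rewrite subr_gt0.
  have [r r0 Hr] := cg _ Ip _ e0.
  have [x Ex px] := sup_adherent r0 hasE; rewrite -/p in px.
  have xp := Ep _ Ex; case: Ex => xv gx.
  have Ix : `[0, 1]%classic x by rewrite /= in_itv/=; lra.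
  by have := Hr x Ix; rewrite !ger0_norm; lra.
have gp_ge : p <= g p.
  rewrite leNgt; apply/negP => gp.
  have pv' : p < v.
    by rewrite lt_neqAle pv andbT; apply: contraTneq gp => ->; rewrite gv; lra.
  have A0 : 0 < 1 + `|a| by have := normr_ge0 a; lra.
  pose s := Num.min (Num.min d (v - p)) ((p - g p) / (1 + `|a|)).
  have s0 : 0 < s by rewrite !lt_min d0 subr_gt0 pv'/= divr_gt0// subr_gt0.
  have sd : s <= d by rewrite !ge_min lexx.
  have sv : s <= v - p by rewrite !ge_min lexx orbT.
  have sp : s <= (p - g p) / (1 + `|a|) by rewrite !ge_min lexx orbT.
  clearbody s; have := @above (p + s); rewrite Hd; last by rewrite sd ltW.
  rewrite ler_pdivlMr// in sp.
  have : a * s <= `|a| * s by rewrite ler_pM2r// ler_norm.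
  lra.
have gp : g p = p by apply/eqP; rewrite eq_le gp_le.
have pv' : p < v.
  by rewrite lt_neqAle pv andbT; apply: contra_eq_neq gp => ->; rewrite gv; lra.
pose d' := Num.min d (v - p).
have d'0 : 0 < d' by rewrite lt_min d0 subr_gt0.
have d'd : d' <= d by rewrite ge_min lexx.
have d'v : d' <= v - p by rewrite ge_min lexx orbT.
clearbody d'.
have a1 : 1 < a.
  have := @above (p + d'); rewrite Hd ?gp; last by rewrite d'd ltW.
  have : (1 < a) = (d' < a * d') by rewrite -ltr_pdivrMr// divff// gt_eqF.
  by move=> ->; lra.
exists p, a, d'; split=> //; first lra.
by move=> s sd; rewrite Hd ?gp//; lra.
Qed.

Variables (p a d : R).
Hypothesis P : repelling g v p a d.
Local Notation knot := (knot g v).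

Lemma knot_gt_fixed N n : (0 < n)%N -> (n <= 2 ^ N)%N -> p < knot N n.
Proof.
have [ug v01 inc dec g0 g1 gv] := G; have [p0 d0 pd a1 gp _ above] := P.
move=> n0; elim: N => [|N IHN] nN.
  by have -> : n = 1%N; [rewrite expn0 in nN; lia|rewrite /=; lra].
have [nN'|nN'] := leqP n (2 ^ N).
  rewrite ltNge; apply/negP => kp.
  have := @g_mono _ _ _ G (knot N.+1 n) p; rewrite g_knot_left// gp.
  by have := IHN nN'; have := knot_itv G nN; lra.
by have := knot_le G (ltnW nN') nN; rewrite knot_half//; lra.
Qed.

Lemma knot_decr N n : (0 < n)%N -> (n <= 2 ^ N)%N -> knot N.+1 n < knot N n.
Proof.
move=> n0 nN; have nN' : (n <= 2 ^ N.+1)%N by rewrite expnS; lia.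
rewrite -[ltRHS](g_knot_left G nN); apply: (repelling_above P).
  exact: knot_gt_fixed.
by rewrite -[leRHS](knot_half G N) knot_le// leq_exp2l.
Qed.

Lemma knot_antitone N N' n : (0 < n)%N -> (n <= 2 ^ N)%N -> (N <= N')%N ->
  knot N' n <= knot N n.
Proof.
move=> n0 nN; elim: N' => [|N' IHN']; first by rewrite leqn0 => /eqP->.
rewrite leq_eqVlt => /predU1P[<-//|]; rewrite ltnS => NN'.
apply: le_trans (IHN' NN'); apply/ltW/knot_decr => //.
by rewrite (leq_trans nN)// leq_exp2l.
Qed.

(** The n-th knots decrease with N; their infimum L satisfies g L <= L, as each
    of them is the image of the next, so L cannot lie beyond p. *)
Lemma knot_near n r : (0 < n)%N -> 0 < r ->
  exists N, (n <= 2 ^ N)%N /\ knot N n < p + r.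
Proof.
move=> n0 r0.
have [ug v01 inc dec g0 g1 gv] := G; have [p0 d0 pd a1 gp _ above] := P.
pose E := [set knot N n | N in [set N | (n <= 2 ^ N)%N]].
have nn : (n <= 2 ^ n)%N by rewrite ltnW// ltn_expl.
have lbE : lbound E p by move=> _ [N /= nN <-]; apply/ltW/knot_gt_fixed.
have hasE : has_inf E by split; [exists (knot n n), n|exists p].
have infE N : (n <= 2 ^ N)%N -> inf E <= knot N n.
  by move=> nN; apply: ge_inf; [case: hasE|exists N].
have pE : p <= inf E by apply: lb_le_inf => //; exists (knot n n), n.
have Ev : inf E <= v.
  rewrite (le_trans (infE n.+1 _))//; first by rewrite (leq_trans nn)//
    leq_exp2l.
  by rewrite -[leRHS](knot_half G n) knot_le// leq_exp2l.
have {pE Ev}E_eq : inf E = p.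
  apply/eqP; rewrite eq_le pE andbT leNgt; apply/negP => pE'.
  have : g (inf E) <= inf E.
    apply: lb_le_inf; first by exists (knot n n), n.
    move=> _ [N /= nN <-]; rewrite -(g_knot_left G nN).
    have nN' : (n <= 2 ^ N.+1)%N by rewrite (leq_trans nN)// leq_exp2l.
    apply: (g_mono G); [lra|exact: infE|].
    by rewrite -[leRHS](knot_half G N) knot_le// leq_exp2l.
  by rewrite leNgt above.
have [_ [N nN <-] kE] := inf_adherent r0 hasE.
by exists N; rewrite -E_eq.
Qed.

(** In the linearising coordinate of g at p, one more iteration divides the
    coordinate of the n-th knot by a; z n is that coordinate with the scale
    removed. The doubling law comes from the doubling of indices. *)
Lemma knot_scaling : exists z : nat -> R,
  [/\ forall n N, (0 < n)%N -> (n <= 2 ^ N)%N -> knot N n <= p + d ->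
        knot N n = p + z n / a ^+ N,
      forall n, (0 < n)%N -> 0 < z n,
      forall m n, (0 < m)%N -> (m < n)%N -> z m < z n
    & forall n, (0 < n)%N -> z (2 * n)%N = a * z n].
Proof.
have [p0 d0 pd a1 gp lin above] := P.
have aN N : 0 < a ^+ N by rewrite exprn_gt0//; lra.
pose good n N := (n <= 2 ^ N)%N /\ knot N n <= p + d.
pose F n N := a ^+ N * (knot N n - p).
have FS n N : (0 < n)%N -> good n N -> good n N.+1 /\ F n N.+1 = F n N.
  move=> n0 [nN kN]; have kS := knot_decr n0 nN.
  have nN' : (n <= 2 ^ N.+1)%N by rewrite (leq_trans nN)// leq_exp2l.
  have kp := knot_gt_fixed n0 nN'.
  split; first by split=> //; lra.
  rewrite /F -(g_knot_left G nN) -[in RHS](subrKC p (knot N.+1 n)).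
  by rewrite lin; [rewrite exprS; ring|lra].
have FD n N m : (0 < n)%N -> good n N -> F n (m + N)%N = F n N.
  move=> n0 gN; have : good n (m + N)%N /\ F n (m + N)%N = F n N.
    elim: m => [//|m [gm Fm]]; have [] := FS _ _ n0 gm.
    by rewrite -addSn Fm.
  by case.
have /choice[z zP] : forall n, exists y, forall N,
    (0 < n)%N -> good n N -> F n N = y.
  move=> n; have [n0|n0] := posnP n; first by exists 0 => N; rewrite n0.
  have [N0 [nN0 kN0]] := knot_near n0 d0.
  exists (F n N0) => N _ gN; rewrite -(FD n N N0)// addnC FD//.
  by split=> //; exact: ltW.
have near n : (0 < n)%N -> exists N, good n N.
  move=> /(@knot_near n d)/(_ d0)[N [nN kN]]; exists N; split=> //.
  exact: ltW.
have zE n N : (0 < n)%N -> good n N -> knot N n = p + z n / a ^+ N.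
  by move=> n0 gN; rewrite -(zP n N)// /F mulrC mulKf ?subrKC// gt_eqF.
exists z; split.
- by move=> n N n0 nN kN; exact: zE.
- move=> n n0; have [N gN] := near _ n0; rewrite -(zP n N)// mulr_gt0//.
  by rewrite subr_gt0 knot_gt_fixed//; case: gN.
- move=> m n m0 mn; have n0 : (0 < n)%N := leq_trans (ltn0Sn m) mn.
  have [N [nN kN]] := near _ n0.
  have kmn := knot_lt G mn nN.
  rewrite -(zP n N)// -(zP m N)//; last first.
    by split; [rewrite (leq_trans (ltnW mn))|lra].
  by rewrite ltr_pM2l// ltrD2r.
- move=> n n0; have [N [nN kN]] := near _ n0.
  rewrite -(zP n N)// -(zP _ N.+1) ?muln_gt0//.
    by rewrite /F mul2n knot_double// exprS mulrA.
  by rewrite mul2n; split; [rewrite expnS; lia|rewrite knot_double].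
Qed.

(** By this lemma a map that commutes with g is determined by its restriction
    to any right neighbourhood of p. *)
Lemma orbit_reach r x : 0 < r -> 0 <= x <= 1 ->
  exists N y, [/\ p <= y <= p + r, y <= 1 & iter N g y = x].
Proof.
move=> r0 x01; have [N [N2 kN]] := @knot_near 2 r isT r0.
have [y yN yx] := lap_surj G N2 x01.
have k1 := @knot_gt_fixed N 1 isT (ltnW N2).
have := knot_itv G N2.
by exists N, y; split=> //; lra.
Qed.

End Repelling.

(** * The action of a commutator on the laps *)

Section Commutator.
Variables (R : realType) (g : R -> R) (v p a d : R) (psi : R -> R).
Hypothesis G : unimodal_at g v.
Hypothesis P : repelling g v p a d.
Hypothesis C : nontrivial_pl_commutator g psi.
Local Notation knot := (knot g v).
Implicit Types (x y r s : R) (i j m n N : nat).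

Lemma commutator_itv x : 0 <= x <= 1 -> 0 <= psi x <= 1.
Proof. by move=> x01; apply: unit_map_itv => //; case: C. Qed.

Lemma commutatorP x : 0 <= x <= 1 -> psi (g x) = g (psi x).
Proof.
move=> x01; case: C => _ _ comm _ _; apply/esym.
by have := comm x; rewrite in_itv/=; exact.
Qed.

Lemma commutator_iter N x : 0 <= x <= 1 -> psi (iter N g x) = iter N g (psi x).
Proof.
move=> x01; elim: N => [//|N IHN] /=.
by rewrite commutatorP ?IHN//; exact: (iter_itv G).
Qed.

(** The image q of p is a fixed point, and the slope k of psi on the right of p
    is not 0, or psi would be constant. If q lay on the decreasing branch, g
    would swap the sides of q while psi (p + s) and psi (p + a * s) lie on the
    same side. If psi mapped a right neighbourhood of p below p, then all its
    values would be in [0, p], where g is injective; the points sent to 0 by an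
    iterate of g would then all have the same image, although they accumulate
    at p where psi is injective. Only q = p and k > 0 remain. *)
Lemma commutator_linear : exists k r, [/\ 0 < k, 0 < r, r <= d, k * r <= d &
  forall s, 0 <= s <= r -> psi (p + s) = p + k * s].
Proof.
have [ug v01 inc dec g0 g1 gv] := G; have [p0 d0 pd a1 gp lin above] := P.
have [_ plpsi _ ncst _] := C.
have p01 : 0 <= p < 1 by lra.
have [k [r [r0 pr Hr]]] := piecewise_linear_right plpsi p01.
set q := psi p in Hr.
have q01 : 0 <= q <= 1 by apply: commutator_itv; lra.
have gq : g q = q by rewrite /q -commutatorP ?gp//; lra.
have k0 : k != 0.
  apply/negP => /eqP k0; apply: ncst; exists q => x; rewrite in_itv/= => x01.
  have [N [y [yp y1 <-]]] := orbit_reach G P r0 x01.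
  rewrite commutator_iter; last lra.
  have -> : psi y = q.
    by rewrite -(subrKC p y) Hr ?k0 ?mul0r ?addr0//; lra.
  by elim: N => [//|N IHN]; rewrite iterS IHN.
(* g reverses the order at a fixed point beyond its turning point *)
have qv : q <= v.
  rewrite leNgt; apply/negP => vq.
  have [s [s0 sd sr asr ks]] : exists s, [/\ 0 < s, s <= d, s <= r,
      a * s <= r & v - q <= k * s].
    have K0 : 0 < 1 + `|k| by have := normr_ge0 k; lra.
    pose s := Num.min (Num.min d (r / a)) ((q - v) / (1 + `|k|)).
    have s0 : 0 < s by rewrite !lt_min d0 !divr_gt0//; lra.
    have sd : s <= d by rewrite !ge_min lexx.
    have sr : s <= r / a by rewrite !ge_min lexx orbT.
    have sq : s <= (q - v) / (1 + `|k|) by rewrite !ge_min lexx orbT.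
    clearbody s; rewrite ler_pdivlMr// in sq.
    rewrite ler_pdivlMr in sr; last lra.
    exists s; split=> //; [|by rewrite mulrC|].
      by rewrite (le_trans _ sr)// ler_peMr// ltW.
    have : - k * s <= `|k| * s by rewrite ler_pM2r// -normrN ler_norm.
    lra.
  have e1 : psi (p + s) = q + k * s by apply: Hr; lra.
  have e2 : psi (p + a * s) = q + k * (a * s).
    by apply: Hr; rewrite mulr_ge0//; lra.
  have e3 : g (q + k * s) = q + k * (a * s).
    by rewrite -e1 -commutatorP ?lin//; lra.
  have ps : 0 <= psi (p + s) <= 1 by apply: commutator_itv; lra.
  have as0 : 0 < a * s by rewrite mulr_gt0//; lra.
  case: (ltgtP k 0) k0 => // k0 _.
    have ks0 : k * s < 0 by rewrite nmulr_rlt0.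
    have kas0 : k * (a * s) < 0 by rewrite nmulr_rlt0.
    by have := dec (q + k * s) q; lra.
  have ks0 : 0 < k * s by rewrite mulr_gt0.
  have kas0 : 0 < k * (a * s) by rewrite mulr_gt0.
  by have := dec q (q + k * s); lra.
have qp : q <= p.
  by rewrite leNgt; apply/negP => pq; have := above _ pq qv; rewrite gq ltxx.
have [/andP[/eqP eqp k_gt0]|nqk] := boolP ((q == p) && (0 < k)).
  exists k, (Num.min (Num.min r d) (d / k)); split=> //.
  - by rewrite !lt_min r0 d0 divr_gt0.
  - by rewrite !ge_min lexx orbT.
  - by rewrite mulrC -ler_pdivlMr// !ge_min lexx orbT.
  - move=> s; rewrite !le_min => /andP[s0 /andP[/andP[sr _] _]].
    by rewrite Hr ?eqp// s0.
(* otherwise psi maps the unit interval into [0, p], where g is injective *)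
exfalso.
have [t [t0 tr Ht]] : exists t, [/\ 0 < t, t <= r &
    forall s, 0 <= s <= t -> q + k * s <= p].
  have [eqp|nqp] := eqVneq q p.
    have k_lt0 : k < 0.
      by move: nqk; rewrite eqp eqxx/= -leNgt le_eqVlt (negbTE k0).
    exists r; split=> // s /andP[s0 _].
    by have : k * s <= 0 by [rewrite nmulr_rle0]; lra.
  have q_ltp : q < p by rewrite lt_neqAle nqp.
  have K0 : 0 < 1 + `|k| by have := normr_ge0 k; lra.
  exists (Num.min r ((p - q) / (1 + `|k|))); split.
  - by rewrite lt_min r0 divr_gt0// subr_gt0.
  - by rewrite ge_min lexx.
  move=> s; rewrite le_min ler_pdivlMr// => /and3P[s0 _ sq].
  have : k * s <= `|k| * s by rewrite ler_wpM2r// ler_norm.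
  lra.
have iter_below N x : 0 <= x <= p -> 0 <= iter N g x <= p.
  move=> xp; elim: N => [//|N IHN]; rewrite iterS.
  have := @g_mono _ _ _ G 0 (iter N g x).
  by have := @g_mono _ _ _ G (iter N g x) p; rewrite g0 gp; lra.
have iter_inj N x y : 0 <= x <= p -> 0 <= y <= p ->
    iter N g x = iter N g y -> x = y.
  move=> xp yp; elim: N => [//|N IHN]; rewrite !iterS => e; apply: IHN.
  have := iter_below N _ xp; have := iter_below N _ yp => ? ?.
  by apply: (g_inj_left G) e; lra.
have below x : 0 <= x <= 1 -> 0 <= psi x <= p.
  move=> x01; have [N [y [yp y1 <-]]] := orbit_reach G P t0 x01.
  have y01 : 0 <= y <= 1 by lra.
  rewrite commutator_iter//; apply: iter_below.
  have -> : psi y = q + k * (y - p).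
    by rewrite -[in LHS](subrKC p y) Hr//; lra.
  have := commutator_itv y01.
  rewrite -[in psi y](subrKC p y) Hr; last lra.
  by have := Ht (y - p); lra.
have I0 : 0 <= (0 : R) <= 1 by lra.
have I1 : 0 <= (1 : R) <= 1 by lra.
have gpsi0 : g (psi 0) = psi 0 by rewrite -commutatorP// g0.
have psi10 : psi 1 = psi 0.
  have := below _ I0; have := below _ I1 => ? ?.
  by apply: (g_inj_left G); rewrite -?commutatorP// ?g0 ?g1//; lra.
have [N [N2 kN]] := @knot_near _ _ _ G _ _ _ P 2 t isT t0.
have k1 := knot_gt_fixed G P (isT : 0 < 1)%N (ltnW N2).
have k12 := knot_lt G (isT : 1 < 2)%N N2.
have psi_knot j : (j <= 2 ^ N)%N -> psi (knot N j) = psi 0.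
  move=> jN; have kj := knot_itv G jN; apply: (iter_inj N); try exact: below.
  rewrite -commutator_iter// iter_knot//.
  have -> : iter N g (psi 0) = psi 0.
    by elim: (N) => [//|n IHn]; rewrite iterS IHn.
  by case: (odd j).
have := psi_knot 1%N (ltnW N2); rewrite -(psi_knot 2 N2).
rewrite -(subrKC p (knot N 1)) -(subrKC p (knot N 2)) !Hr; try lra.
move=> /addrI/(mulfI k0); lra.
Qed.

Variables (k r : R).
Hypothesis k_gt0 : 0 < k.
Hypothesis r_gt0 : 0 < r.
Hypothesis r_le : r <= d.
Hypothesis kr_le : k * r <= d.
Hypothesis psi_linear : forall s, 0 <= s <= r -> psi (p + s) = p + k * s.

Lemma commutator_local x : p <= x <= p + r -> psi x = p + k * (x - p).
Proof. by move=> xp; rewrite -[in LHS](subrKC p x) psi_linear//; lra. Qed.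

Lemma commutator_local_lt x y : p <= x -> x < y -> y <= p + r -> psi x < psi y.
Proof.
move=> px xy yp; rewrite !commutator_local ?ltrD2l; try lra.
by rewrite ltr_pM2l//; lra.
Qed.

Lemma commutator_local_inj x y : p <= x <= p + r -> p <= y <= p + r ->
  psi x = psi y -> x = y.
Proof.
move=> xp yp e; case: (ltgtP x y) => // xy.
  by have := @commutator_local_lt x y; rewrite e ltxx; lra.
by have := @commutator_local_lt y x; rewrite e ltxx; lra.
Qed.

(** The N-th iterate g^N has a turning point at the first knot e1, with value 1.
    If psi e1 were interior to a lap, psi and g^N would be injective near e1 and
    psi e1 respectively, and so would be their composite psi \o g^N near e1,
    which contradicts the folding of g^N. So psi e1 is a knot, and psi 1 is its
    image by g^N. *)
Lemma commutator1 : psi 1 = 0 \/ psi 1 = 1.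
Proof.
have [ug v01 inc dec g0 g1 gv] := G; have [p0 d0 pd a1 gp lin above] := P.
have [N [N2 kN]] := @knot_near _ _ _ G _ _ _ P 2 r isT r_gt0.
have N1 : (0 < 2 ^ N)%N by rewrite expn_gt0.
set e1 := knot N 1; set e2 := knot N 2.
have pe1 : p < e1 := knot_gt_fixed G P (isT : 0 < 1)%N N1.
have e12 : e1 < e2 := knot_lt G (isT : 1 < 2)%N N2.
have e1I := knot_itv G N1; have e2I := knot_itv G N2.
rewrite -/e1 -/e2 in e1I e2I kN.
have ge1 : iter N g e1 = 1 by rewrite /e1 (iter_knot G).
have psi_e1 : psi 1 = iter N g (psi e1) by rewrite -commutator_iter// ge1.
apply: contrapT => nend.
have x1I := commutator_itv e1I.
have [i iN /andP[ix1 x1i]] := lap_exists G N x1I.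
have ne j : (j <= 2 ^ N)%N -> psi e1 != knot N j.
  move=> jN; apply/negP => /eqP e; apply: nend; rewrite psi_e1 e iter_knot//.
  by case: (odd j); [right|left].
have {}ix1 : knot N i < psi e1 by rewrite lt_neqAle ix1 eq_sym ne// ltnW.
have {}x1i : psi e1 < knot N i.+1 by rewrite lt_neqAle x1i ne.
(* [x, y] is a neighbourhood of e1 that psi maps into one lap *)
pose x := Num.max p (p + (knot N i - p) / k).
pose y := Num.min e2 (p + (knot N i.+1 - p) / k).
have pe1r : p <= e1 <= p + r by lra.
have xe1 : x < e1.
  rewrite gt_max pe1/= -ltrBrDl ltr_pdivrMr// mulrC.
  by rewrite ltrBlDl -commutator_local.
have e1y : e1 < y.
  rewrite lt_min e12/= -ltrBlDl ltr_pdivlMr// mulrC.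
  by rewrite ltrBrDl -commutator_local.
have px : p <= x by rewrite le_max lexx.
have ye2 : y <= e2 by rewrite ge_min lexx.
have lap t : x <= t <= y -> knot N i <= psi t <= knot N i.+1.
  move=> /andP[xt ty]; rewrite commutator_local; last lra.
  move: xt ty; rewrite ge_max le_min => /andP[pt h1] /andP[_ h2].
  rewrite -lerBrDl ler_pdivrMr// in h1; rewrite -lerBlDl ler_pdivlMr// in h2.
  by rewrite mulrC; lra.
clearbody x y.
have ui := unit_map_iter N ug.
have xI : 0 <= x <= 1 by lra.
have yI : 0 <= y <= 1 by lra.
have top_lt t : 0 <= t <= e2 -> t != e1 -> iter N g t < 1.
  move=> te te1; have tI : 0 <= t <= 1 by lra.
  have /andP[_ h] := iter_itv G N tI; rewrite lt_neqAle h andbT.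
  apply: contra_neq te1 => e; have [t1|t1] := leP t e1.
    apply: (lap_inj G N1); rewrite ?(knot0 G) -?/e1 ?e ?ge1//; lra.
  by apply: (lap_inj G N2); rewrite -?/e1 -?/e2 ?e ?ge1//; lra.
pose w := Num.max (iter N g x) (iter N g y).
have w1 : w < 1 by rewrite gt_max !top_lt//; lra.
have w0 : 0 <= w by rewrite le_max; have /andP[-> _] := iter_itv G N xI.
have [x' x'P gx'] : exists2 c, x <= c <= e1 & iter N g c = w.
  apply: (unit_map_IVT ui);
    rewrite ?ge1 ?ge_min ?le_max ?lexx ?(ltW w1) ?orbT//; lra.
have [y' y'P gy'] : exists2 c, e1 <= c <= y & iter N g c = w.
  apply: (unit_map_IVT ui);
    rewrite ?ge1 ?ge_min ?le_max ?lexx ?(ltW w1) ?orbT//; lra.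
have x'e1 : x' != e1 by apply: contraTneq w1 => e; rewrite -gx' e ge1 ltxx.
have /lap l1 : x <= x' <= y by lra.
have /lap l2 : x <= y' <= y by lra.
have : psi x' = psi y'.
  apply: (lap_inj G iN l1 l2); rewrite -!commutator_iter ?gx' ?gy'//; lra.
move/(@commutator_local_inj x' y'); move: x'e1; rewrite neq_lt; lra.
Qed.

Lemma commutator0 : psi 0 = 0.
Proof.
have [_ _ _ _ g0 g1 _] := G.
rewrite -[in LHS]g1 commutatorP ?lexx ?ler01//.
by case: commutator1 => ->.
Qed.

Variable z : nat -> R.
Hypothesis zP : forall n N, (0 < n)%N -> (n <= 2 ^ N)%N ->
  knot N n <= p + d -> knot N n = p + z n / a ^+ N.
Hypothesis z_gt0 : forall n, (0 < n)%N -> 0 < z n.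
Hypothesis z_lt : forall m n, (0 < m)%N -> (m < n)%N -> z m < z n.
Hypothesis z2 : forall n, (0 < n)%N -> z (2 * n)%N = a * z n.

Lemma scaling_inj m n : (0 < m)%N -> (0 < n)%N -> z m = z n -> m = n.
Proof.
move=> m0 n0 e; case: (ltngtP m n) => // mn.
  by have := z_lt m0 mn; rewrite e ltxx.
by have := z_lt n0 mn; rewrite e ltxx.
Qed.

Lemma commutator_knot n N : (0 < n)%N -> (n <= 2 ^ N)%N -> knot N n <= p + r ->
  exists m, [/\ (0 < m)%N, (m <= 2 ^ N)%N, psi (knot N n) = knot N m
    & z m = k * z n].
Proof.
have [p0 d0 pd a1 gp lin above] := P => n0 nN kN.
have aN : a ^+ N != 0 by rewrite gt_eqF// exprn_gt0//; lra.
have kp := knot_gt_fixed G P n0 nN; have kI := knot_itv G nN.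
have [m mN e] : exists2 m, (m <= 2 ^ N)%N & psi (knot N n) = knot N m.
  apply: (knotP G (commutator_itv kI)).
  rewrite -commutator_iter// (iter_knot G)//; case: (odd n); last left.
    exact: commutator1.
  exact: commutator0.
have psik : psi (knot N n) = p + k * (knot N n - p).
  by rewrite commutator_local//; lra.
have kk0 : 0 < k * (knot N n - p) by rewrite mulr_gt0//; lra.
have kkd : k * (knot N n - p) <= d.
  by rewrite (le_trans _ kr_le)// ler_pM2l//; lra.
have m0 : (0 < m)%N.
  by rewrite lt0n; apply/eqP => m0; move: psik; rewrite e m0 (knot0 G); lra.
exists m; split=> //; move: (e).
rewrite psik (zP n0 nN); last by have := r_le; lra.
rewrite (zP m0 mN); last by rewrite -e psik; lra.
move/addrI; rewrite addrAC subrr add0r mulrA => /(mulIf _) -> //.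
by rewrite invr_neq0.
Qed.

(** Since psi preserves {0, 1}, it sends knots to knots, and near p it
    multiplies the coordinate by k. *)
Lemma commutator_index : exists sigma : nat -> nat,
  (forall n, (0 < n)%N -> (0 < sigma n)%N /\ z (sigma n) = k * z n) /\
  (forall n N, (0 < n)%N -> (n <= 2 ^ N)%N -> knot N n <= p + r ->
     (sigma n <= 2 ^ N)%N /\ psi (knot N n) = knot N (sigma n)).
Proof.
have /choice[sigma sigmaP] : forall n, exists m,
    (0 < n)%N -> (0 < m)%N /\ z m = k * z n.
  move=> n; have [->|n0] := posnP n; first by exists 0%N.
  have [N [nN kN]] := knot_near G P n0 r_gt0.
  by have [m [m0 _ _ zm]] := commutator_knot n0 nN (ltW kN); exists m.
exists sigma; split=> [//|n N n0 nN kN].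
have [m [m0 mN e zm]] := commutator_knot n0 nN kN.
have [s0 zs] := sigmaP _ n0.
by have -> : sigma n = m by apply: scaling_inj => //; rewrite zs zm.
Qed.

Lemma commutator_index_lt sigma : 
  (forall n, (0 < n)%N -> (0 < sigma n)%N /\ z (sigma n) = k * z n) ->
  forall m n, (0 < m)%N -> (m < n)%N -> (sigma m < sigma n)%N.
Proof.
move=> sigmaP m n m0 mn; have n0 := leq_ltn_trans (leq0n m) mn.
have [sm0 zm] := sigmaP _ m0; have [sn0 zn] := sigmaP _ n0.
have zmn : z (sigma m) < z (sigma n) by rewrite zm zn ltr_pM2l// z_lt.
rewrite ltnNge leq_eqVlt; apply/negP => /predU1P[e|nm].
  by move: zmn; rewrite e ltxx.
by have := lt_trans zmn (z_lt sn0 nm); rewrite ltxx.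
Qed.

(** A lap near p is sent by psi onto sigma n.+1 - sigma n laps. This number does
    not depend on the lap: g^N identifies any two laps, and as g^N \o psi = psi
    \o g^N this identification transports, through psi, the knots of the image
    of one lap to those of the image of the other. The transport is an injection
    between finite index sets, and exchanging the laps gives equality. *)
Lemma commutator_index_gap sigma n n' :
  (forall n, (0 < n)%N -> (0 < sigma n)%N /\ z (sigma n) = k * z n) ->
  (forall n N, (0 < n)%N -> (n <= 2 ^ N)%N -> knot N n <= p + r ->
     (sigma n <= 2 ^ N)%N /\ psi (knot N n) = knot N (sigma n)) ->
  (0 < n)%N -> (0 < n')%N ->
  (sigma n.+1 - sigma n <= sigma n'.+1 - sigma n')%N.
Proof.
move=> sigmaP psiP n0 n'0.
have slt := commutator_index_lt sigmaP.
have [N [nnN kN]] := @knot_near _ _ _ G _ _ _ P (maxn n n').+1 r isT r_gt0.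
have small j : (j <= (maxn n n').+1)%N -> (j <= 2 ^ N)%N /\ knot N j <= p + r.
  move=> jn; split; first exact: leq_trans nnN.
  by apply: le_trans (ltW kN); exact: knot_le.
have lapP j : (0 < j)%N -> (j <= maxn n n')%N -> 
    [/\ (j < 2 ^ N)%N, p < knot N j, knot N j.+1 <= p + r,
     (sigma j.+1 <= 2 ^ N)%N & psi (knot N j) = knot N (sigma j) /\
     psi (knot N j.+1) = knot N (sigma j.+1)].
  move=> j0 jn; have [jN kj] := small j (leqW jn).
  have [j1N kj1] := small j.+1 jn.
  have [_ e] := psiP _ _ j0 jN kj.
  have [s1N e1] := psiP _ _ (isT : 0 < j.+1)%N j1N kj1.
  by split=> //; exact: (knot_gt_fixed G P).
have [nN pn n1r s1N [en en1]] := lapP n n0 (leq_maxl _ _).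
have [n'N pn' n'1r s'1N [en' en'1]] := lapP n' n'0 (leq_maxr _ _).
have sn := slt _ _ n0 (ltnSn n); have sn' := slt _ _ n'0 (ltnSn n').
have index_le (i : 'I_(sigma n.+1 - sigma n).+1) :
    (sigma n + i <= sigma n.+1)%N.
  by rewrite -[leqRHS](subnKC (ltnW sn)) leq_add2l -ltnS ltn_ord.
have /choice[f fP] : forall i : 'I_(sigma n.+1 - sigma n).+1,
    exists j : 'I_(sigma n'.+1 - sigma n').+1, exists x x',
    [/\ knot N n <= x <= knot N n.+1, psi x = knot N (sigma n + i),
        knot N n' <= x' <= knot N n'.+1, iter N g x' = iter N g x &
        psi x' = knot N (sigma n' + j)].
  move=> i; have iN := index_le i; have iN2 := leq_trans iN s1N.
  have ki : knot N (sigma n) <= knot N (sigma n + i) <= knot N (sigma n.+1).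
    by rewrite !(knot_le G)// leq_addr.
  pose x := p + (knot N (sigma n + i) - p) / k.
  have kx : k * (x - p) = knot N (sigma n + i) - p.
    by rewrite /x addrAC subrr add0r mulrCA divff ?mulr1// gt_eqF.
  have kn : knot N n < knot N n.+1 := knot_ltS G nN.
  have xn : knot N n <= x <= knot N n.+1.
    rewrite -en -en1 !commutator_local in ki; try lra.
    have -> : (knot N n <= x) = (k * (knot N n - p) <= k * (x - p)).
      by rewrite ler_pM2l// lerD2r.
    have -> : (x <= knot N n.+1) = (k * (x - p) <= k * (knot N n.+1 - p)).
      by rewrite ler_pM2l// lerD2r.
    by rewrite kx; lra.
  have psix : psi x = knot N (sigma n + i).
    by rewrite commutator_local ?kx ?subrKC//; lra.
  have xI : 0 <= x <= 1.
    by have := knot_itv G nN; have := knot_itv G (ltnW nN); lra.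
  have [x' x'n gx'] := lap_surj G n'N (iter_itv G N xI).
  have x'I : 0 <= x' <= 1.
    by have := knot_itv G n'N; have := knot_itv G (ltnW n'N); lra.
  have [j jN ej] : exists2 j, (j <= 2 ^ N)%N & psi x' = knot N j.
    apply: (knotP G (commutator_itv x'I)).
    rewrite -commutator_iter// gx' commutator_iter// psix (iter_knot G)//.
    by case: (odd _); [right|left].
  have kn' : knot N n' < knot N n'.+1 := knot_ltS G n'N.
  have kj : knot N (sigma n') <= knot N j <= knot N (sigma n'.+1).
    rewrite -ej -en' -en'1 !commutator_local; try lra.
    by rewrite !lerD2l !ler_pM2l// !lerD2r.
  have jge : (sigma n' <= j)%N.
    rewrite leqNgt; apply/negP => /(knot_lt G)/(_ (leq_trans (ltnW sn') s'1N)).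
    lra.
  have jle : (j <= sigma n'.+1)%N.
    by rewrite leqNgt; apply/negP => /(knot_lt G)/(_ jN); lra.
  have jP : (j - sigma n' < (sigma n'.+1 - sigma n').+1)%N.
    by rewrite ltnS leq_sub2r.
  exists (Ordinal jP), x, x'; split=> //=.
  by rewrite subnKC.
have finj : injective f.
  move=> i1 i2 e.
  have [x1 [x1' [x1n ex1 x1n' g1 ef1]]] := fP i1.
  have [x2 [x2' [x2n ex2 x2n' g2 ef2]]] := fP i2.
  have ex' : x1' = x2'.
    by apply: commutator_local_inj; rewrite ?ef1 ?ef2 ?e//; lra.
  have ex : x1 = x2 by apply: (lap_inj G nN) => //; rewrite -g1 -g2 ex'.
  apply: val_inj; apply: (@addnI (sigma n)).
  apply: (knot_inj G (N := N)); try by rewrite (leq_trans (index_le _)).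
  by rewrite -ex1 -ex2 ex.
by have := leq_card f finj; rewrite !card_ord ltnS.
Qed.

(** By [orbit_reach] it is enough that the two maps agree near p. *)
Lemma commutator_iterate t : k = a ^+ t -> {in `[0, 1], psi =1 iter t g}.
Proof.
have [p0 d0 pd a1 gp lin above] := P.
move=> kE x; rewrite in_itv/= => x01.
have rI : 0 < Num.min r (d / k) by rewrite lt_min r_gt0 divr_gt0.
have [N [y [yp y1 <-]]] := orbit_reach G P rI x01.
have yr : y - p <= r.
  by rewrite lerBlDl (le_trans (andP yp).2)// lerD2l ge_min lexx.
have yd : (y - p) * k <= d.
  rewrite -ler_pdivlMr// lerBlDl (le_trans (andP yp).2)// lerD2l.
  by rewrite ge_min lexx orbT.
have giter u : (u <= t)%N -> iter u g y = p + a ^+ u * (y - p).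
  elim: u => [|u IHu] ut; first by rewrite expr0 mul1r subrKC.
  rewrite iterS IHu 1?ltnW// lin; first by rewrite exprS mulrA.
  rewrite mulr_ge0 ?exprn_ge0//=; try lra.
  rewrite (le_trans _ yd)// kE mulrC ler_wpM2l//; first lra.
  by rewrite ler_weXn2l// ?ltW// ltnW.
rewrite commutator_iter; last lra.
rewrite -iterD addnC iterD giter// -kE commutator_local//; lra.
Qed.

(** Constant gaps and the doubling law force sigma n = sigma 1 * n, so that the
    number of laps M = sigma 1 is what psi multiplies indices by. *)
Lemma commutator_scaling : exists M, [/\ (0 < M)%N, forall t, (M <> 2 ^ t)%N &
  forall n, (0 < n)%N -> z (M * n)%N = k * z n].
Proof.
have [p0 d0 pd a1 gp lin above] := P.
have [sigma [sigmaP psiP]] := commutator_index.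
have gap m n : (0 < m)%N -> (0 < n)%N ->
    (sigma m.+1 - sigma m = sigma n.+1 - sigma n)%N.
  by move=> m0 n0; apply/eqP; rewrite eqn_leq !commutator_index_gap.
have slt := commutator_index_lt sigmaP.
have s2 : sigma 2%N = (2 * sigma 1)%N.
  have [s0 z1] := sigmaP 1%N isT; have [s20 zs2] := sigmaP 2%N isT.
  apply: scaling_inj; rewrite ?muln_gt0 ?s0// zs2 z2// z1.
  by rewrite (z2 (isT : 0 < 1)%N); ring.
have sE n : (0 < n)%N -> sigma n = (sigma 1 * n)%N.
  case: n => // n _; elim: n => [|n IHn]; first by rewrite muln1.
  have := gap n.+1 1%N isT isT; rewrite s2.
  have := slt n.+1 n.+2 isT (ltnSn _).
  by rewrite mulnS -IHn; lia.
have [s0 zs1] := sigmaP 1%N isT.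
exists (sigma 1%N); split=> // [t st|n n0].
  have z2X u : z (2 ^ u)%N = a ^+ u * z 1%N.
    elim: u => [|u IHu]; first by rewrite expr0 mul1r.
    by rewrite expnS z2 ?expn_gt0// IHu exprS mulrA.
  have kE : k = a ^+ t.
    by apply: (mulIf (lt0r_neq0 (z_gt0 (isT : 0 < 1)%N))); rewrite -zs1 st z2X.
  by case: C => _ _ _ _; apply; exists t; exact: commutator_iterate.
by rewrite -sE//; case: (sigmaP _ n0).
Qed.

End Commutator.

(** * Rigidity of the scaling *)

Lemma pow2_succ_le i : (2 ^ i + 1 <= 2 ^ i.+1)%N.
Proof. by rewrite expnS mul2n -addnn leq_add2l expn_gt0. Qed.

Section Rigidity.
Variables (R : realType) (g : R -> R) (v p a d : R).
Hypothesis G : unimodal_at g v.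
Hypothesis pl : piecewise_linear g.
Local Notation knot := (knot g v).

(** The iterate g^(N+2) vanishes at x0 = knot N.+1 1 and is affine on its right.
    Near x0 lie the knots of index 2 ^ i + 1, which it sends to first knots of a
    lower level, whose coordinate is known. The increments of the power n ^ al
    at 2 ^ i are therefore of the form excluded by [increments_rigid] unless
    p = 0 and al = 1. *)
Lemma power_law_rigid z : repelling g v p a d ->
  (forall n N, (0 < n)%N -> (n <= 2 ^ N)%N ->
    knot N n <= p + d -> knot N n = p + z n / a ^+ N) ->
  0 < z 1%N ->
  (forall n, (0 < n)%N -> z n = z 1%N * n%:R `^ (ln a / ln 2)) ->
  p = 0 /\ a = 2.
Proof.
move=> P zP z10; set al := ln a / ln 2 => zE.
have [p0 d0 pd a1 gp lin above] := P.
have [ug v01 inc dec g0 g1 gv] := G.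
have a0 : 0 < a by lra.
have al0 : 0 < al by rewrite divr_gt0 ?ln_gt0// ltr1n.
have al2 : 2 `^ al = a := powR_log2 a0.
have aX N : 0 < a ^+ N by rewrite exprn_gt0.
have [[|N] [N2 kN]] := @knot_near _ _ _ G _ _ _ P 2 d isT d0; first by [].
have N1 : (0 < 2 ^ N.+1)%N by rewrite expn_gt0.
set x0 := knot N.+1 1.
have x0I := knot_itv G N1.
have k12 : x0 < knot N.+1 2 := knot_lt G (isT : 1 < 2)%N N2.
have x0E : x0 = p + z 1%N / a ^+ N.+1 by apply: zP => //; rewrite -/x0; lra.
have x01 : 0 <= x0 < 1 by rewrite -/x0 in x0I; have := knot_itv G N2; lra.
have ug' := unit_map_iter N.+2 ug.
have pl' := piecewise_linear_iter N.+2 ug pl.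
have [be [eta [eta0 _ lin']]] := piecewise_linear_right pl' x01.
have Gx0 : iter N.+2 g x0 = 0 by rewrite iterS iter_knot.
have y_le i : knot (i + N.+1) (2 ^ i + 1) <= p + d.
  apply: (le_trans _ (ltW kN)); rewrite -[leRHS](knot_pow2 G i N2).
  rewrite (knot_le G)//.
    by rewrite mulnC -expnS pow2_succ_le.
  by rewrite expnD leq_pmul2l// expn_gt0.
have y_lt i : (2 ^ i + 1 <= 2 ^ (i + N.+1))%N.
  by rewrite (leq_trans (pow2_succ_le i))// leq_exp2l// addnS ltnS leq_addr.
have yE i : knot (i + N.+1) (2 ^ i + 1) - x0 =
    z 1%N / a ^+ N.+1 * (((2 ^ i + 1)%:R `^ al - (2 ^ i)%:R `^ al) / a ^+ i).
  rewrite zP//; last by rewrite addn1.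
  rewrite zE ?addn1// x0E exprD.
  have -> : (2 ^ i)%:R `^ al = a ^+ i by rewrite natrX powRX// al2.
  have := aX i; have := aX N.+1; move: (a ^+ i) (a ^+ N.+1) => u w u0 w0.
  by field; rewrite !gt_eqF.
have Gy i : iter N.+2 g (knot (i.+1 + N.+1) (2 ^ i.+1 + 1)) = knot i 1.
  have e : (i.+1 + N.+1 = N + i.+2)%N by rewrite !addSn !addnS addnC.
  rewrite e (iterD 2 N) (iter_knot_left G); last first.
    exact: pow2_succ_le.
  rewrite -[iter 2 g _]/(g (g _)) (g_knot_right G); first last.
  - exact: pow2_succ_le.
  - by rewrite leq_addr.
  rewrite (_ : (2 ^ i.+2 - (2 ^ i.+1 + 1) = 2 ^ i.+1 - 1)%N); last first.
    by rewrite subnDA (expnS 2 i.+1) mul2n -addnn addnK.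
  rewrite (g_knot_right G) ?leq_subr//; last first.
    by rewrite leq_subRL ?expn_gt0// addnC pow2_succ_le.
  by rewrite subKn// expn_gt0.
have [I0 [I01 kI0]] := @knot_near _ _ _ G _ _ _ P 1 d isT d0.
have eta' : 0 < eta / (z 1%N / a ^+ N.+1) by rewrite !divr_gt0.
have [I1] := increments_small al0 eta'; rewrite al2 => I1P.
have [p_eq0 al1] : p = 0 /\ al = 1.
  apply: (@increments_rigid R al (be * (z 1%N / a ^+ N.+1)) p (z 1%N * a)
    (maxn I0.+1 I1)) => //; first by rewrite mulr_gt0.
  move=> [|i]; rewrite geq_max// => /andP[I0i I1i]; rewrite al2.
  have ki : knot i 1 = p + z 1%N / a ^+ i.
    apply: zP; rewrite ?expn_gt0//.
    by apply: (le_trans _ (ltW kI0)); apply: (knot_antitone G P).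
  have : be * (knot (i.+1 + N.+1) (2 ^ i.+1 + 1) - x0) = knot i 1.
    rewrite -Gy -[in RHS](subrKC x0 (knot _ _)) lin' ?Gx0 ?add0r//.
    apply/andP; split.
      rewrite subr_ge0 /x0 -[leLHS](knot_pow2 G i.+1 N1) knot_le// muln1.
      by rewrite leq_addr.
    rewrite yE mulrC -ler_pdivlMr ?divr_gt0// ler_pdivrMr//.
    exact: I1P.
  rewrite yE ki !(exprS a i); set D := _ - _.
  have := aX i; have := aX N.+1; move: (a ^+ i) (a ^+ N.+1) => u w w0 u0 e.
  have -> : be * (z 1%N / w) * D = be * (z 1%N / w * (D / (a * u))) * (a * u).
    by field; rewrite !gt_eqF.
  by rewrite e; field; rewrite gt_eqF.
by split=> //; rewrite -al2 al1 powRr1.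
Qed.

End Rigidity.


(** * Conjugacy with the tent map *)

Lemma dyadic_between (R : realType) (x y : R) : 0 <= x -> x < y ->
  exists i n, x < n%:R / 2 ^+ i.+1 < y.
Proof.
move=> x0 xy; have [i hi] := @expr_unbounded R 2 (y - x)^-1 (ltr1n _ _).
have p2 : 0 < 2 ^+ i.+1 :> R by rewrite exprn_gt0.
have {}hi : (y - x)^-1 < 2 ^+ i.+1.
  by rewrite (lt_trans hi)// ltr_eXn2l// ltr1n.
exists i, (Num.truncn (2 ^+ i.+1 * x)).+1.
have /truncn_itv/andP[t1 t2] : 0 <= 2 ^+ i.+1 * x by rewrite mulr_ge0// ltW.
rewrite ltr_pdivlMr// ltr_pdivrMr// mulrC t2/= -natr1.
have : (y - x) * (y - x)^-1 < (y - x) * 2 ^+ i.+1.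
  by rewrite ltr_pM2l// subr_gt0.
rewrite divff ?gt_eqF ?subr_gt0//; lra.
Qed.

Section Conjugacy.
Variables (R : realType) (g : R -> R) (v d : R) (z : nat -> R).
Hypothesis G : unimodal_at g v.
Hypothesis pl : piecewise_linear g.
Local Notation knot := (knot g v).

(** When the knots near 0 are equally spaced, the conjugacy is the iterate g^N
    restricted to its first lap [0, e], rescaled to the unit interval: it sends
    n / 2 ^ i to knot i n. It is piecewise linear as an iterate of g, it
    intertwines the increasing branches because g doubles distances near 0, and
    the decreasing branches because it does so at dyadic points. *)
Lemma tent_conjugate : repelling g v 0 2 d ->
  (forall n N, (0 < n)%N -> (n <= 2 ^ N)%N ->
    knot N n <= d -> knot N n = z 1%N * n%:R / 2 ^+ N) ->
  exists h, conjugacy (@tent R) g h /\ piecewise_linear h.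
Proof.
move=> P zP; have [_ d0 dv _ _ lin _] := P.
have [ug v01 inc dec g0 g1 gv] := G.
have [N [N1 kN]] := @knot_near _ _ _ G _ _ _ P 1 d isT d0.
rewrite add0r in kN; set e := knot N 1 in kN *.
have e0 : 0 < e := knot_gt_fixed G P (isT : 0 < 1)%N N1.
have eI := knot_itv G N1; rewrite -/e in eI.
have eE : e = z 1%N / 2 ^+ N by rewrite /e zP ?mulr1// ltW.
pose l x : R := e * x.
have ul : unit_map l.
  split; first by move=> x /=; rewrite !in_itv/= /l => x01; nra.
  apply/within_continuous_epsP => x _ r r0; exists (r / e).
    exact: divr_gt0.
  by move=> y _; rewrite -mulrBr normrM gtr0_norm// ltr_pdivlMr// mulrC.
have pll : piecewise_linear l.
  split; first by case: ul.
  exists [:: `[0, 1]]; split; first by rewrite set_cons1 bigcup_set1.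
  by move=> i _; exists e, 0 => x _; rewrite addr0.
pose h := iter N g \o l.
have uh : unit_map h := unit_map_comp ul (unit_map_iter N ug).
have plh : piecewise_linear h.
  apply: piecewise_linear_comp => //; first exact: unit_map_iter.
  exact: piecewise_linear_iter.
have hI x : 0 <= x <= 1 -> 0 <= h x <= 1 by exact: unit_map_itv.
have h_lt x y : 0 <= x -> x < y -> y <= 1 -> h x < h y.
  move=> x0 xy y1; apply: (first_lap_inc G); rewrite -/e /l.
  - by rewrite mulr_ge0// ltW.
  - by rewrite ltr_pM2l.
  - by rewrite -[leRHS]mulr1 ler_pM2l.
have h_ltW x y : 0 <= x <= 1 -> 0 <= y <= 1 -> h x < h y -> x < y.
  move=> x01 y01 hxy; rewrite ltNge le_eqVlt; apply/negP => /predU1P[yx|yx].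
    by move: hxy; rewrite yx ltxx.
  by have := h_lt y x; lra.
have h_inj x y : 0 <= x <= 1 -> 0 <= y <= 1 -> h x = h y -> x = y.
  move=> x01 y01 hxy; case: (ltgtP x y) => // xy.
    by have := h_lt x y; lra.
  by have := h_lt y x; lra.
have h0 : h 0 = 0.
  by rewrite /h /l/= mulr0 -[X in iter _ _ X](knot0 G N) iter_knot.
have h1 : h 1 = 1 by rewrite /h /l/= mulr1 iter_knot.
have h_surj y : 0 <= y <= 1 -> exists2 x, 0 <= x <= 1 & h x = y.
  move=> y01; apply: (unit_map_IVT uh); rewrite ?lexx//.
  by rewrite h0 h1 minElt maxElt ltr01.
have h_dyadic i n : (n <= 2 ^ i)%N -> h (n%:R / 2 ^+ i) = knot i n.
  move=> ni; have [->|n0] := posnP n; first by rewrite mul0r h0 (knot0 G).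
  have niN : (n <= 2 ^ (N + i))%N.
    by rewrite (leq_trans ni)// leq_exp2l// leq_addl.
  have lE : l (n%:R / 2 ^+ i) = knot (N + i) n.
    rewrite zP//; last first.
      apply: (le_trans _ (ltW kN)); rewrite -[leRHS](knot_pow2 G i N1) addnC.
      by rewrite (knot_le G)// ?muln1// leq_exp2l// leq_addr.
    by rewrite /l eE exprD; field; rewrite !expf_neq0.
  by rewrite -[LHS]/(iter N g (l _)) lE (iter_knot_left G).
have conj_left x : 0 <= x <= 2^-1 -> h (2 * x) = g (h x).
  move=> x2; rewrite /h /= -iterS iterSr; congr iter.
  by rewrite /l -[X in g X]add0r lin ?add0r; [ring|]; nra.
have h_half : h 2^-1 = v.
  have := h_dyadic 1%N 1%N isT; rewrite mul1r expr1 => ->.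
  exact: (knot_half G 0).
have h_ge x : 2^-1 <= x <= 1 -> v <= h x <= 1.
  move=> x1; have : 0 <= x <= 1 by lra.
  move/hI => /andP[_ ->]; rewrite andbT -h_half.
  case: (ltgtP x 2^-1) => [|hx|->//]; first by lra.
  by apply/ltW/h_lt; lra.
have conj_dyadic i n (x : R) : x = n%:R / 2 ^+ i.+1 -> 2^-1 <= x <= 1 ->
    g (h x) = h (2 - 2 * x).
  move=> xE; have p2 : 0 < 2 ^+ i.+1 :> R by rewrite exprn_gt0.
  have nE : n%:R = x * 2 ^+ i.+1 by rewrite xE divfK// gt_eqF.
  rewrite -(ler_pM2r p2) -[X in _ && X](ler_pM2r p2) -nE mul1r.
  rewrite {1}exprS mulKf// -!natrX !ler_nat => /andP[n1 n2].
  have -> : 2 - 2 * x = (2 ^ i.+1 - n)%:R / 2 ^+ i.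
    by rewrite natrB// natrX nE exprS; field; rewrite expf_neq0.
  rewrite xE !h_dyadic ?(g_knot_right G)//.
  by rewrite leq_subLR expnS mul2n -addnn leq_add2r.
have conj_right x : 2^-1 <= x <= 1 -> g (h x) = h (2 - 2 * x).
  move=> x1; have x01 : 0 <= x <= 1 by lra.
  have ghI : 0 <= g (h x) <= 1 by apply: unit_map_itv ug _; exact: hI.
  have [w w01 hw] := h_surj _ ghI.
  have hx1 := h_ge _ x1.
  rewrite -hw; congr h; case: (ltgtP w (2 - 2 * x)) => // wx; exfalso.
    have [||i [n]] := @dyadic_between R x (1 - w / 2); [lra|lra|].
    move Et: (_ / _) => t xt; have conjt := conj_dyadic i n _ (esym Et).
    have := dec (h x) (h t); have := h_lt x t; have := h_ge t.
    by have := h_ltW (2 - 2 * t) w; rewrite -conjt ?hw; lra.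
  have [||i [n]] := @dyadic_between R (1 - w / 2) x; [lra|lra|].
  move Et: (_ / _) => t xt; have conjt := conj_dyadic i n _ (esym Et).
  have := dec (h t) (h x); have := h_lt t x; have := h_ge t.
  by have := h_ltW w (2 - 2 * t); rewrite -conjt ?hw; lra.
exists h; split=> //; split; last first.
  move=> x; rewrite in_itv/= => x01; rewrite /tent.
  have [x2|x2] := leP x 2^-1.
    by rewrite ger0_norm ?opprB -?conj_left; [congr h; ring|lra|lra].
  by rewrite ler0_norm ?conj_right; [congr h; ring|lra|lra].
split=> //.
have /choice[k kP] : forall y, exists x, 0 <= y <= 1 -> 0 <= x <= 1 /\ h x = y.
  move=> y; have [y01|ny] := boolP (0 <= y <= 1); last by exists 0.
  by have [x x01 hx] := h_surj _ y01; exists x.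
have hK : {in `[0, 1], cancel h k}.
  move=> x; rewrite in_itv/= => x01; have [kI hk] := kP _ (hI _ x01).
  exact: h_inj.
exists k; split=> //.
  split; first by move=> y /=; rewrite !in_itv/= => /kP[].
  have := @segment_can_le_continuous R 0 1 h k ler01 uh.2 hK.
  by rewrite h0 h1.
by move=> y; rewrite in_itv/= => /kP[].
Qed.

End Conjugacy.

Theorem theorem1 (R : realType) (g : R -> R)
    (g_unimodal : unimodal g) (g_pl : piecewise_linear g)
    (g_comm : exists psi : R -> R, nontrivial_pl_commutator g psi) :
  exists h : R -> R, conjugacy (@tent R) g h /\ piecewise_linear h.
Proof.
have [v G] := unimodalP g_unimodal.
have [psi C] := g_comm.
have [p [a [d P]]] := repelling_exists G g_pl.
have [k [r [k0 r0 rd krd psi_lin]]] := commutator_linear G P C.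
have [z [zP z0 z_lt z2]] := knot_scaling G P.
have [M [M0 Mpow zM]] :=
  commutator_scaling G P C k0 r0 rd krd psi_lin zP z0 z_lt z2.
have zE := power_law (repelling_slope P) z0 z_lt z2 zM M0 Mpow.
have [p_eq0 a_eq2] := power_law_rigid G g_pl P zP (z0 1%N isT) zE.
move: P zP zE; rewrite p_eq0 a_eq2 => P zP zE.
apply: (tent_conjugate G g_pl (z := z) P) => n N n0 nN kN.
have l2 : ln 2 / ln 2 = 1 :> R by rewrite divff// gt_eqF// ln_gt0// ltr1n.
rewrite zP ?add0r// zE// l2 powRr1//.
Qed.
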